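(* Let $\mathcal{M}$ be the set of stable matchings of an instance of the stable marriage problem, let $P=S(\mathcal{M})$ be the stable matching polytope, and let $d$ be the dimension of $P$. Then $f_0(P)f_{d-1}(P)\leq d2^{d+1}$, and equality holds if and only if $P$ is affinely isomorphic to the $d$-dimensional cube or the $d$-dimensional cross-polytope.
   Context: For a $d$-dimensional polytope $P$, $f_0(P)$ is its number of vertices and $f_{d-1}(P)$ its number of facets. Convention for $d=0$: a point has no facets, so the product is $0$, and the $0$-dimensional cube and cross-polytope are points. The $d$-dimensional cube is $[-1,1]^d$ and the $d$-dimensional cross-polytope is its polar. An instance of the stable marriage problem is a complete bipartite graph $G(M\cup W,E)$ with $|M|=|W|=n$, and for each vertex $v$ a strict linear order $<_v$ on the neighbors of $v$, where $a<_v b$ means that $v$ prefers $b$ to $a$. A stable matching is a perfect matching $\mu\subseteq E$ such that, writing $\mu(v)$ for the partner of $v$, for every $mw\in E\setminus\mu$ either $m<_w\mu(w)$ or $w<_m\mu(m)$. The stable matching polytope $S(\mathcal{M})\subseteq\mathbb{R}^E$ is the convex hull of the characteristic vectors of all stable matchings. *)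

(* Defs.v *)
From HB Require Import structures.
From mathcomp Require Import all_boot all_order all_algebra finmap.
From mathcomp Require Import boolp classical_sets functions cardinality reals.

Set Implicit Arguments.
Unset Strict Implicit.
Unset Printing Implicit Defensive.

Import Order.TTheory GRing.Theory Num.Theory.

Local Open Scope classical_set_scope.
Local Open Scope ring_scope.

Section Polytopes.
Variables (R : realType) (V : vectType R).
Implicit Types (A P F : set V) (d k : nat).

Definition conv_hull A : set V :=
  [set x | exists (k : nat) (p : 'I_k -> V) (a : 'I_k -> R),
    [/\ forall i, A (p i), forall i, 0 <= a i, \sum_i a i = 1
      & x = \sum_i a i *: p i]].

Definition aff_hull A : set V :=
  [set x | exists (k : nat) (p : 'I_k -> V) (a : 'I_k -> R),
    [/\ forall i, A (p i), \sum_i a i = 1 & x = \sum_i a i *: p i]].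

(* The affine hull of A is a translate of a linear subspace of dimension d.   *)
(* For nonempty A this holds of exactly one d; set0 has no dimension.         *)
Definition has_dim A d : Prop :=
  exists (x0 : V) (U : {vspace V}),
    aff_hull A = [set x | x - x0 \in U] /\ \dim U = d.

Definition face P F : Prop :=
  exists (c : {linear V -> R^o}) (b : R),
    (forall x, P x -> c x <= b) /\ F = [set x | P x /\ c x = b].

Definition vertices P : set (set V) := [set F | face P F /\ has_dim F 0].

(* A set of dimension 0 has no facets: its face set0 has no dimension. *)
Definition facets P : set (set V) :=
  [set F | face P F /\ exists k, has_dim F k /\ has_dim P k.+1].

(* fset_set is meaningful on finite sets only; a polytope has finitely many   *)
(* faces.                                                                     *)
Definition num_vertices P : nat := #|` fset_set (vertices P)|.
Definition num_facets P : nat := #|` fset_set (facets P)|.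

End Polytopes.

(* The affine map need only be bijective between the two sets, so that they   *)
(* may live in spaces of different dimensions.                                *)
Definition affinely_isomorphic (R : realType) (V V' : vectType R)
    (P : set V) (Q : set V') : Prop :=
  exists (f : {linear V -> V'}) (b : V'), set_bij P Q (fun x => f x + b).

Definition cube (R : realType) (d : nat) : set 'rV[R]_d :=
  [set x | forall i, -1 <= x 0 i <= 1].
Arguments cube : clear implicits.

Definition polar (R : realType) (d : nat) (A : set 'rV[R]_d) : set 'rV[R]_d :=
  [set y | forall x, A x -> \sum_i x 0 i * y 0 i <= 1].

Definition cross_polytope (R : realType) (d : nat) : set 'rV[R]_d :=
  polar (cube R d).
Arguments cross_polytope : clear implicits.

Definition strict_linear_order (T : eqType) (lt : rel T) : Prop :=
  [/\ irreflexive lt, transitive lt & forall x y, x != y -> lt x y || lt y x].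

(* ltM m w w' means that m prefers w' to w, and likewise for ltW. *)
Record marriage_instance (M W : finType) := MarriageInstance {
  ltM : M -> rel W;
  ltW : W -> rel M;
  ltM_order : forall m, strict_linear_order (ltM m);
  ltW_order : forall w, strict_linear_order (ltW w)
}.

Section StableMatchings.
Variables (M W : finType).
Implicit Types (I : marriage_instance M W) (mu : {set M * W}).

Definition perfect_matching mu : bool :=
  [forall m, #|[set w | (m, w) \in mu]| == 1%N] &&
  [forall w, #|[set m | (m, w) \in mu]| == 1%N].

(* Partners are unique in a perfect matching, so the existentials below       *)
(* merely name mu(w) and mu(m).                                               *)
Definition stable_matching I mu : bool :=
  perfect_matching mu &&
  [forall m, forall w, ((m, w) \notin mu) ==>
     [exists m', ((m', w) \in mu) && ltW I w m m'] ||
     [exists w', ((m, w') \in mu) && ltM I m w w']].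

Definition char_vec (R : realType) mu : {ffun M * W -> R^o} :=
  [ffun e => (e \in mu)%:R].

Definition stable_matching_polytope (R : realType) I :
    set {ffun M * W -> R^o} :=
  conv_hull [set x | exists2 mu, stable_matching I mu & x = char_vec R mu].

End StableMatchings.
Arguments stable_matching_polytope {M W} R I _.

(* Main.v *)
From HB Require Import structures.
Require Import Defs.
From mathcomp Require Import boolp classical_sets functions cardinality reals.
From mathcomp Require Import all_boot all_order all_algebra finmap zify lra.

Set Implicit Arguments.
Unset Strict Implicit.
Unset Printing Implicit Defensive.

Import Order.TTheory GRing.Theory Num.Theory.

(** Encode a stable matching by its profile, the set of pairs (m, w) such that m
    is matched to w or better.  The stable matchings form a lattice in which
    every man gets the better, or the worse, of his two partners, so the
    profiles are closed under union and intersection ([profilesU], [profilesI]).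
    Characteristic vector and indicator of the profile determine each other by
    an invertible linear map.  Merging the pairs that no profile separates and
    dropping those that lie in all profiles or in none ([ring_quotient]), the
    polytope P becomes affinely isomorphic to the convex hull in R^d of the
    indicators of the members of a ring G of subsets of a d-element set X, with
    G containing the empty set and X and separating the points
    ([stable_polytope_ring]).  Such a G consists of the ideals of a partial order
    on X, and P is an order polytope; in particular d is the dimension of P.

    Every vertex of P is the point of a member of G.  Every facet of P comes from
    an edge of the Hasse diagram of X with a least and a greatest element added:
    if none of the equations x_p = x_q (p covered by q), x_p = 1 (p minimal),
    x_p = 0 (p maximal) holds on all of a face, then any p can be added to one
    maximiser of the supporting functional and removed from another, so the
    functional has weight zero at every p ([weight_eq0], [ring_polytope_facets]).
    Hence f_0 f_(d-1) is at most the number of ideals times the number of edges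
    (and is 0 for d = 0).

    To bound this product, let N be the set of elements that are not both minimal
    and maximal.  There are at most |N| + 2(d - |N|) edges at the added elements,
    and there are at most 2^d ideals.  Ideals correspond to antichains, which are
    independent in the cover graph, and this graph has no triangle; for such a
    graph, independent sets times edges is at most |N| 2^d ([stable_edge_bound]).
    The sum is at most 2 d 2^d, and strictly smaller unless all subsets are
    ideals ([ring_edges_le], [ring_edges_eq]); in that case P is a cube.

    Conversely, if P is affinely isomorphic to the cube or to the cross-polytope,
    it has at least the evident faces of these: the 2^d sign vectors and the 2d
    signed unit vectors give the vertices of one and the facets of the other.
    With the upper bound this forces equality. *)

(** * Rings of sets *)

Section RingsOfSets.
Variable X : finType.
Implicit Types (G : {set {set X}}) (A B : {set X}) (p q r : X).

Definition set_ring G : Prop :=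
  [/\ set0 \in G, [set: X] \in G,
      forall A B, A \in G -> B \in G -> A :&: B \in G
    & forall A B, A \in G -> B \in G -> A :|: B \in G].

Definition separating G : Prop :=
  forall p q, (forall A, A \in G -> (p \in A) = (q \in A)) -> p = q.

(** For a separating ring this is the partial order whose ideals are the members. *)
Definition ring_le G : rel X :=
  fun p q => [forall A in G, (q \in A) ==> (p \in A)].

Definition ring_lt G : rel X := fun p q => (p != q) && ring_le G p q.

Definition ring_cover G : rel X :=
  fun p q => ring_lt G p q && [forall r, ~~ (ring_lt G p r && ring_lt G r q)].

Definition ring_min G p : bool := [forall q, ~~ ring_lt G q p].
Definition ring_max G p : bool := [forall q, ~~ ring_lt G p q].

Definition ring_compl G : {set {set X}} := [set ~: A | A : {set X} in G].

Lemma ring_leP G p q :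
  reflect (forall A, A \in G -> q \in A -> p \in A) (ring_le G p q).
Proof.
apply: (iffP forall_inP) => [h A GA|h A GA]; first exact/implyP/h.
by apply/implyP/h.
Qed.

Lemma ring_le_refl G : reflexive (ring_le G).
Proof. by move=> p; apply/ring_leP. Qed.

Lemma ring_le_trans G : transitive (ring_le G).
Proof.
by move=> q p r /ring_leP pq /ring_leP qr; apply/ring_leP => A GA /(qr _ GA)/(pq _ GA).
Qed.

Lemma mem_ring_compl G A : (A \in ring_compl G) = (~: A \in G).
Proof.
apply/imsetP/idP => [[B GB ->]|GA]; first by rewrite setCK.
by exists (~: A); rewrite ?setCK.
Qed.

Lemma ring_compl_set_ring G : set_ring G -> set_ring (ring_compl G).
Proof.
move=> [G0 GT GI GU]; split; rewrite ?mem_ring_compl ?setC0 ?setCT //.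
- by move=> A B; rewrite !mem_ring_compl setCI; apply: GU.
- by move=> A B; rewrite !mem_ring_compl setCU; apply: GI.
Qed.

Lemma ring_compl_separating G : separating G -> separating (ring_compl G).
Proof.
move=> sG p q pq; apply: sG => A GA; apply: negb_inj.
by rewrite -!in_setC; apply: pq; rewrite mem_ring_compl setCK.
Qed.

Lemma ring_compl_le G p q : ring_le (ring_compl G) p q = ring_le G q p.
Proof.
apply/ring_leP/ring_leP => h A GA.
  move=> pA; apply: contraLR (pA) => qA; rewrite -in_setC; apply: h.
    by rewrite mem_ring_compl setCK.
  by rewrite in_setC.
move: GA; rewrite mem_ring_compl => /h; rewrite !in_setC.
by move=> hA qA; apply: contraLR qA.
Qed.

Lemma ring_compl_lt G p q : ring_lt (ring_compl G) p q = ring_lt G q p.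
Proof. by rewrite /ring_lt ring_compl_le eq_sym. Qed.

Lemma ring_compl_cover G p q : ring_cover (ring_compl G) p q = ring_cover G q p.
Proof.
rewrite /ring_cover ring_compl_lt; congr (_ && _).
by apply: eq_forallb => r; rewrite !ring_compl_lt andbC.
Qed.

Lemma ring_compl_min G p : ring_min (ring_compl G) p = ring_max G p.
Proof. by apply: eq_forallb => q; rewrite ring_compl_lt. Qed.

Section Order.
Variable G : {set {set X}}.
Hypotheses (rG : set_ring G) (sG : separating G).

Lemma ring_le_anti p q : ring_le G p q -> ring_le G q p -> p = q.
Proof.
move=> /ring_leP pq /ring_leP qp; apply: sG => A GA.
by apply/idP/idP => [/(qp _ GA)|/(pq _ GA)].
Qed.

Lemma ring_lt_trans : transitive (ring_lt G).
Proof.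
move=> q p r /andP[npq pq] /andP[nqr qr]; rewrite /ring_lt (ring_le_trans pq qr) andbT.
by apply: contraNneq npq => pr; apply/eqP/ring_le_anti => //; rewrite pr.
Qed.

Lemma ring_lt_asym p q : ring_lt G p q -> ~~ ring_lt G q p.
Proof.
move=> pq; apply/negP => /(ring_lt_trans pq).
by rewrite /ring_lt eqxx.
Qed.

Lemma ring_lt_sep p q : ring_lt G p q ->
  exists A, [/\ A \in G, p \in A & q \notin A].
Proof.
move=> /andP[npq pq].
have : ~~ ring_le G q p by apply: contra npq => qp; apply/eqP/ring_le_anti.
by case/forall_inPn => A GA; rewrite negb_imply => /andP[]; exists A.
Qed.

Lemma ring_bigcup (I : finType) (P : pred I) (F : I -> {set X}) :
  (forall i, P i -> F i \in G) -> \bigcup_(i | P i) F i \in G.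
Proof. by case: rG => G0 _ _ GU hF; elim/big_ind: _. Qed.

Lemma ring_bigcap (I : finType) (P : pred I) (F : I -> {set X}) :
  (forall i, P i -> F i \in G) -> \bigcap_(i | P i) F i \in G.
Proof. by case: rG => _ GT GI _ hF; elim/big_ind: _. Qed.

(** Birkhoff's description of a ring of sets: the least member containing q is
    the principal ideal of q, and every ideal is a union of those. *)
Lemma ideal_in_ring A :
  (forall p q, ring_le G p q -> q \in A -> p \in A) -> A \in G.
Proof.
move=> hA; pose down q := \bigcap_(B in G | q \in B) B.
have -> : A = \bigcup_(q in A) down q.
  apply/setP => p; apply/idP/bigcupP => [pA|[q qA /bigcapP pq]].
    by exists p => //; apply/bigcapP => B /andP[].
  apply: hA qA; apply/ring_leP => B GB qB; apply: pq; exact/andP.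
by apply: ring_bigcup => q qA; apply: ring_bigcap => B /andP[].
Qed.

Lemma ring_ideal A p q : A \in G -> ring_le G p q -> q \in A -> p \in A.
Proof. by move=> GA /ring_leP; apply. Qed.

Lemma ring_le_lt_trans p q r : ring_le G p q -> ring_lt G q r -> ring_lt G p r.
Proof.
move=> pq qr; have [->//|npq] := eqVneq p q.
by apply: ring_lt_trans qr; rewrite /ring_lt npq.
Qed.

(** Pairs of members differing in one prescribed point: they make all coordinate
    directions parallel to the span of the indicators. *)
Lemma principal_ideal p : exists A, [/\ A \in G, p \in A & A :\ p \in G].
Proof.
exists [set q | ring_le G q p]; rewrite inE ring_le_refl; split => //.
  by apply: ideal_in_ring => q r; rewrite !inE; apply: ring_le_trans.
apply: ideal_in_ring => q r qr; rewrite !inE => rp.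
exact: ring_le_lt_trans qr rp.
Qed.

Lemma maximal_below (P : pred X) p r0 : P r0 -> ring_lt G r0 p ->
  exists r, [/\ P r, ring_lt G r p
              & forall t, ring_lt G r t -> ring_lt G t p -> ~~ P t].
Proof.
move=> P0 r0p; pose down q := #|[set t | ring_le G t q]|.
pose Q := [pred r | P r && ring_lt G r p].
have Q0 : Q r0 by rewrite /= P0.
case: (@arg_maxnP _ r0 Q down Q0) => r /andP[Pr rp] rmax; exists r; split=> // t rt tp.
apply/negP => Pt; have := rmax t; rewrite /= Pt tp => /(_ isT).
apply/negP; rewrite -ltnNge; apply: proper_card; apply/properP; split.
  apply/subsetP => u; rewrite !inE => ur.
  by case/andP: (ring_le_lt_trans ur rt).
exists t; rewrite !inE ?ring_le_refl //.
by apply/negP => tr; move: (ring_le_lt_trans tr rt); rewrite /ring_lt eqxx.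
Qed.

End Order.
End RingsOfSets.

Section Weights.
Local Open Scope ring_scope.
Variables (R : realDomainType) (X : finType).
Implicit Types (G : {set {set X}}) (w : X -> R) (b : R).

(** The members of largest weight b form a sublattice.  Take the union J of those
    avoiding p: it contains everything below p, for otherwise a maximal missing
    element is covered by p, and the member separating the two would be part of
    J.  So J can be enlarged by p, and this cannot increase its weight. *)
Lemma weight_le0 G w b p :
    set_ring G -> separating G ->
    (forall A, A \in G -> \sum_(q in A) w q <= b) ->
    (ring_min G p -> exists A, [/\ A \in G, \sum_(q in A) w q = b & p \notin A]) ->
    (forall r, ring_cover G r p ->
       exists A, [/\ A \in G, \sum_(q in A) w q = b, r \in A & p \notin A]) ->
  w p <= 0.
Proof.
move=> rG sG hb hmin hcov; have [G0 GT GI GU] := rG.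
pose tight := [pred A : {set X} | (A \in G) && (\sum_(q in A) w q == b)].
have modular (A B : {set X}) : \sum_(q in A :|: B) w q + \sum_(q in A :&: B) w q
    = \sum_(q in A) w q + \sum_(q in B) w q.
  rewrite [\sum_(q in A :|: B) _](big_setID A) /= setUK setDUl setDv set0U.
  rewrite [\sum_(q in B) _](big_setID A) /= -addrA; congr (_ + _).
  by rewrite addrC setIC.
have tightU A B : tight A -> tight B -> tight (A :|: B).
  move=> /andP[GA /eqP wA] /andP[GB /eqP wB]; rewrite /= GU //= eq_le hb ?GU //=.
  rewrite -(lerD2r (\sum_(q in A :&: B) w q)) modular wA wB lerD2l.
  by apply: hb; apply: GI.
pose J := \bigcup_(A | tight A && (p \notin A)) A.
have JG : J \in G by apply: ring_bigcup => // A /andP[/andP[]].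
have pJ : p \notin J by apply/negP => /bigcupP[A /andP[_ /negP]].
have below r : ring_lt G r p -> r \in J.
  move=> rp; apply/negPn/negP => rJ.
  have [s [sJ sp smax]] := maximal_below sG (P := fun t => t \notin J) rJ rp.
  have cov : ring_cover G s p.
    rewrite /ring_cover sp; apply/forallP => t; apply/negP => /andP[st tp].
    have /negPn tJ := smax t st tp; case/negP: sJ.
    by apply: ring_ideal JG _ tJ; case/andP: st.
  have [A [GA wA sA pA]] := hcov s cov; case/negP: sJ.
  by apply/bigcupP; exists A => //; rewrite /= GA wA eqxx.
have tJ : tight J.
  have [A] : exists A, tight A && (p \notin A).
    have [pmin|] := boolP (ring_min G p).
      by have [A [GA wA pA]] := hmin pmin; exists A; rewrite /= GA wA eqxx.
    case/forallPn => r /negPn /below /bigcupP[A hA _]; by exists A.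
  (* adding A to each term makes the union nonempty at every stage *)
  move=> hA; have -> : J = \bigcup_(B | tight B && (p \notin B)) (A :|: B).
    apply/setP => q; apply/bigcupP/bigcupP => -[B hB qB].
      by exists B => //; rewrite inE qB orbT.
    by case/setUP: qB => qB; [exists A | exists B].
  have : (\bigcup_(B | tight B && (p \notin B)) (A :|: B) == set0) ||
         tight (\bigcup_(B | tight B && (p \notin B)) (A :|: B)).
    elim/big_ind: _ => [|B C|B /andP[tB _]]; first by rewrite eqxx.
      case/orP=> [/eqP->|tB]; first by rewrite set0U.
      case/orP=> [/eqP->|tC]; first by rewrite setU0 tB orbT.
      by rewrite (tightU B C) ?orbT.
    by rewrite (tightU A B) ?orbT //; case/andP: hA.
  case/orP=> [/eqP e|//]; rewrite e.
  have /andP[tA _] := hA; have A0 : A = set0; last by rewrite -A0.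
  apply/eqP; rewrite -subset0 -e; apply/subsetP => q qA.
  by apply/bigcupP; exists A => //; rewrite inE qA.
have /andP[_ /eqP wJ] := tJ.
have : p |: J \in G.
  apply: ideal_in_ring => // q r qr; rewrite !inE.
  case/orP=> [/eqP rp|rJ]; last by rewrite (ring_ideal JG qr rJ) orbT.
  have [//|npq] := eqVneq q p; rewrite below //= /ring_lt npq -rp //.
move/hb; rewrite big_setU1 //= wJ -[leRHS]add0r lerD2r //.
Qed.

(** The opposite inequality is the same statement for the complements of the
    members with negated weights, which reverses the order. *)
Lemma weight_eq0 G w b p :
    set_ring G -> separating G ->
    (forall A, A \in G -> \sum_(q in A) w q <= b) ->
    (ring_min G p -> exists A, [/\ A \in G, \sum_(q in A) w q = b & p \notin A]) ->
    (ring_max G p -> exists A, [/\ A \in G, \sum_(q in A) w q = b & p \in A]) ->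
    (forall r q, ring_cover G r q ->
       exists A, [/\ A \in G, \sum_(q in A) w q = b, r \in A & q \notin A]) ->
  w p = 0.
Proof.
move=> rG sG hb hmin hmax hcov; apply/eqP; rewrite eq_le (weight_le0 rG sG hb) //=;
  last by move=> r; apply: hcov.
rewrite -oppr_le0.
have sumC (A : {set X}) :
    \sum_(q in ~: A) - w q = \sum_(q in A) w q - \sum_q w q.
  rewrite sumrN [\sum_q w q](bigID (mem A)) /= opprD addNKr //.
  by congr (- _); apply: eq_bigl => q; rewrite inE.
apply: (weight_le0 (G := ring_compl G) (w := fun q => - w q) (b := b - \sum_q w q)).
- exact: ring_compl_set_ring.
- exact: ring_compl_separating.
- by move=> A; rewrite mem_ring_compl => /hb; rewrite -{2}[A]setCK sumC lerD2r.
- rewrite ring_compl_min => /hmax[A [GA wA pA]]; exists (~: A).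
  by rewrite mem_ring_compl setCK sumC wA inE pA.
- move=> r; rewrite ring_compl_cover => /hcov[A [GA wA pA rA]]; exists (~: A).
  by rewrite mem_ring_compl setCK sumC wA !inE pA rA.
Qed.

End Weights.

(** * Independent sets and edges of a triangle-free graph *)

Section StableSetsAndEdges.
Variables (X : finType) (e : rel X) (N : {set X}).

Definition independent_sets : {set {set X}} :=
  [set A : {set X} | [forall p in A, forall q in A, ~~ e p q]].

Definition adj p q := e p q || e q p.

Lemma independentP (A : {set X}) :
  reflect (forall p q, p \in A -> q \in A -> ~~ adj p q) (A \in independent_sets).
Proof.
rewrite inE; apply: (iffP forall_inP) => [h p q pA qA|h p pA].
  rewrite /adj negb_or.
  by have /forall_inP -> := h p pA => //; have /forall_inP -> := h q qA.
by apply/forall_inP => q qA; have := h p q pA qA; rewrite negb_or => /andP[].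
Qed.

Hypothesis e_asym : forall p q, e p q -> ~~ e q p.
Hypothesis e_tri : forall p q r, adj p q -> adj q r -> ~~ adj p r.
Hypothesis e_N : forall p q, e p q -> p \in N /\ q \in N.

Let adjC p q : adj p q = adj q p. Proof. by rewrite /adj orbC. Qed.
Let adjxx p : adj p p = false.
Proof. by apply/negP; rewrite /adj orbb => h; move: (e_asym h); rewrite h. Qed.

Let pair_sets : {set {set X} * (X * X)} :=
  [set t | (t.1 \in independent_sets) && e t.2.1 t.2.2].

Let ends (t : X * X) : {set X} := [set t.1; t.2].
Let hull (t : {set X} * (X * X)) : {set X} := t.1 :|: ends t.2.

(** Any two edges of W whose removal leaves an independent set must meet; one of
    them, if there is any, serves as the origin for naming the others. *)
Let origin (W : {set X}) : option (X * X) :=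
  [pick u | [&& e u.1 u.2, ends u \subset W & W :\: ends u \in independent_sets]].

(** An end of u that identifies u inside W: away from the origin it is the end
    not shared with the origin. *)
Let tip W (u : X * X) : X :=
  if origin W is Some u0 then
    if u == u0 then u.1 else if u.1 \in ends u0 then u.2 else u.1
  else u.1.

Let code (t : {set X} * (X * X)) : {set X} * X :=
  if t.2.1 \in t.1 then (hull t, t.2.1)
  else if t.2.2 \in t.1 then (hull t, t.2.2)
  else (hull t :\ tip (hull t) t.2, tip (hull t) t.2).

Let tip_ends W u : tip W u \in ends u.
Proof.
by rewrite /tip; case: (origin W) => [u0|]; do ?case: ifP => _; rewrite !inE eqxx ?orbT.
Qed.

Let orient p q p' q' : e p q -> e p' q' -> [set p; q] = [set p'; q'] -> (p, q) = (p', q').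
Proof.
move=> pq pq' h.
have : p \in [set p'; q'] by rewrite -h !inE eqxx.
have : q \in [set p'; q'] by rewrite -h !inE eqxx orbT.
rewrite !inE => /orP[]/eqP qe /orP[]/eqP pe; move: pq pq'; rewrite qe pe //.
- by move=> h1; move: (e_asym h1); rewrite h1.
- by move=> h1; move: (e_asym h1) => /negbTE->.
- by move=> h1; move: (e_asym h1); rewrite h1.
Qed.

(** When w lies in A, the other end of the edge is the only neighbour of w in the
    union, so w and the union determine the edge and A. *)
Let code_in_inj A u A' u' w :
  A \in independent_sets -> A' \in independent_sets ->
  e u.1 u.2 -> e u'.1 u'.2 -> w \in A -> w \in A' -> w \in ends u -> w \in ends u' ->
  A :|: ends u = A' :|: ends u' -> (A, u) = (A', u').
Proof.
have aux (B : {set X}) (v : X * X) :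
  B \in independent_sets -> e v.1 v.2 -> w \in B -> w \in ends v ->
  exists x, [/\ ends v = [set w; x], adj w x, B = (B :|: ends v) :\ x &
      forall y, y \in B :|: ends v -> adj w y -> y = x].
  move=> /independentP iB ev wB wv.
  have [x [vx wx]] : exists x, ends v = [set w; x] /\ adj w x.
    move: wv; rewrite !inE => /orP[]/eqP->; first by exists v.2; rewrite /adj ev.
    by exists v.1; rewrite /adj ev orbT setUC.
  have xB : x \notin B by apply/negP => xB; have := iB _ _ wB xB; rewrite wx.
  exists x; split => //.
    apply/setP => y; rewrite vx !inE; case: eqVneq => [->|nyx] /=; first exact/negbTE.
    by rewrite orbF; case: eqVneq => [->|_]; rewrite ?wB ?orbF.
  move=> y; rewrite vx !inE => /orP[yB|/orP[/eqP->|/eqP->//]].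
    by move=> wy; have := iB _ _ wB yB; rewrite wy.
  by rewrite adjxx.
move=> iA iA' eu eu' wA wA' wu wu' h.
have [x [ux wx Ax xu]] := aux A u iA eu wA wu.
have [x' [ux' wx' Ax' xu']] := aux A' u' iA' eu' wA' wu'.
have xx : x' = x.
  by apply: xu wx'; rewrite h ux' !inE eqxx !orbT.
congr (_, _); first by rewrite Ax Ax' h xx.
move: eu eu' ux ux'; rewrite xx; case: u {wu h Ax xu} => p q; case: u' {wu' Ax' xu'} => p' q' /=.
by move=> pq pq' <- ?; apply: orient.
Qed.

(** Two edges distinct from the origin with the same tip both meet the origin; if
    they met it in different ends, there would be a triangle. *)
Let code_out_inj (W : {set X}) u u' :
  e u.1 u.2 -> e u'.1 u'.2 -> ends u \subset W -> ends u' \subset W ->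
  W :\: ends u \in independent_sets -> W :\: ends u' \in independent_sets ->
  tip W u = tip W u' -> u = u'.
Proof.
move=> eu eu' uW uW' iu iu'; rewrite /tip /origin; case: pickP => [u0|none]; last first.
  by have := none u; rewrite eu uW iu.
move=> /and3P[e0 _ /independentP i0].
have meet (v : X * X) : e v.1 v.2 -> ends v \subset W -> v != u0 ->
    exists x y, [/\ ends v = [set x; y], x \in ends u0, y \notin ends u0, adj x y &
      (if v.1 \in ends u0 then v.2 else v.1) = y].
  move=> ev /subsetP vW vu0.
  have v1W : v.1 \in W by apply: vW; rewrite !inE eqxx.
  have v2W : v.2 \in W by apply: vW; rewrite !inE eqxx orbT.
  have nv : v.1 != v.2.
    by apply: contraTneq ev => <-; apply/negP => h; move: (e_asym h); rewrite h.
  case: ifPn => v1; last first.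
    exists v.2, v.1; rewrite setUC /adj ev orbT; split => //.
    apply/negPn/negP => v2; have := i0 v.1 v.2.
    by rewrite !in_setD v1 v2 v1W v2W /adj ev => /(_ isT isT).
  exists v.1, v.2; rewrite /adj ev; split => //.
  apply: contra vu0 => v2.
  case: v u0 ev e0 v1 v2 nv {i0 vW v1W v2W} => p q [p' q'] /= pq pq' v1 v2 nv.
  apply/eqP/orient => //; apply/eqP; rewrite eqEcard !cards2 nv.
  have -> /= : p' != q' by apply: contraTneq pq' => <-; apply/negP => h; move: (e_asym h); rewrite h.
  by rewrite andbT; apply/subsetP => z; rewrite !inE => /orP[]/eqP->; move: v1 v2; rewrite !inE.
have u01 : u0.1 \in ends u0 by rewrite !inE eqxx.
case: (eqVneq u u0) => [uu|nu]; case: (eqVneq u' u0) => [uu'|nu'].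
- by rewrite uu uu'.
- have [x [y [_ _ yu0 _ ->]]] := meet u' eu' uW' nu'.
  by rewrite uu => h; move: yu0; rewrite -h u01.
- have [x [y [_ _ yu0 _ ->]]] := meet u eu uW nu.
  by rewrite uu' => h; move: yu0; rewrite h u01.
have [x [y [uxy xu0 yu0 xy ->]]] := meet u eu uW nu.
have [x' [y' [uxy' xu0' yu0' xy' ->]]] := meet u' eu' uW' nu'.
move=> yy; rewrite -yy in uxy' xy' *.
have xx : x = x'.
  apply/eqP/negPn/negP => nxx.
  have adj_xx : adj x x'.
    move: xu0 xu0' nxx; rewrite !inE => /orP[]/eqP-> /orP[]/eqP->; rewrite ?eqxx //= /adj e0 ?orbT //.
  by have := e_tri xy; rewrite adjC in xy'; move=> /(_ _ xy'); rewrite adj_xx.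
have uu' : ends u = ends u' by rewrite uxy uxy' xx.
by case: u u' eu eu' uu' {uW uW' iu iu' nu nu' uxy uxy'} => p q [p' q']; apply: orient.
Qed.

(** An independent set A and an edge u are recovered from their union W and one
    vertex w of N: the common vertex if A meets u, the tip of u otherwise.  In the
    second case w is also removed from W, which tells the two cases apart. *)
Lemma stable_edge_bound :
  #|independent_sets| * #|[set u : X * X | e u.1 u.2]| <= #|N| * 2 ^ #|X|.
Proof.
have -> : #|independent_sets| * #|[set u : X * X | e u.1 u.2]| = #|pair_sets|.
  rewrite -cardsX; apply: eq_card => -[A u]; rewrite !inE //.
have -> : #|N| * 2 ^ #|X| = #|setX [set: {set X}] N|.
  by rewrite cardsX -powersetT card_powerset cardsT mulnC.
have code_sub : {in pair_sets, forall t, code t \in setX [set: {set X}] N}.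
  move=> [A [p q]]; rewrite !inE /= => /andP[_ pq]; have [pN qN] := e_N pq.
  rewrite /code /=; do 2?case: ifP => //= _.
  by have := tip_ends (hull (A, (p, q))) (p, q); rewrite !inE => /orP[]/eqP->.
rewrite -(card_in_imset (f := code) (D := pair_sets)); last first.
  move=> [A u] [A' u']; rewrite ![_ \in pair_sets]inE => /andP[/= iA eu] /andP[/= iA' eu'].
  have in_or B v : code (B, v) = (hull (B, v), v.1) /\ v.1 \in B
      \/ code (B, v) = (hull (B, v), v.2) /\ v.2 \in B
      \/ [/\ code (B, v) = (hull (B, v) :\ tip (hull (B, v)) v, tip (hull (B, v)) v),
             v.1 \notin B & v.2 \notin B].
    rewrite /code /=; case: ifPn => h1; first by left.
    by case: ifPn => h2; right; [left | right].
  have in_or2 B v : (exists w, [/\ code (B, v) = (hull (B, v), w), w \in B & w \in ends v])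
      \/ [/\ code (B, v) = (hull (B, v) :\ tip (hull (B, v)) v, tip (hull (B, v)) v)
            & hull (B, v) :\: ends v = B].
    case: (in_or B v) => [[-> h]|[[-> h]|[-> h1 h2]]].
    - by left; exists v.1; rewrite !inE eqxx.
    - by left; exists v.2; rewrite !inE eqxx orbT.
    right; split => //; rewrite /hull setDUl setDv setU0.
    apply/setP => z; rewrite !inE; case: eqVneq => [->|_] /=; first by rewrite (negbTE h1).
    by case: eqVneq => [->|_] //=; rewrite (negbTE h2).
  have tipW B v : tip (hull (B, v)) v \in hull (B, v).
    by rewrite in_setU tip_ends orbT.
  case: (in_or2 A u) => [[w [-> wA wu]]|[-> hA]];
  case: (in_or2 A' u') => [[w' [-> wA' wu']]|[-> hA']] [hW hw].
  - by move: wA' wu'; rewrite -hw => wA' wu'; apply: (code_in_inj (w := w)).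
  - have : w \in hull (A, u) by rewrite inE wA.
    by rewrite hW hw !inE eqxx.
  - have : w' \in hull (A', u') by rewrite inE wA'.
    by rewrite -hW -hw !inE eqxx.
  have hh : hull (A, u) = hull (A', u').
    by rewrite -(setD1K (tipW A u)) hW hw setD1K ?tipW.
  have uu : u = u'.
    apply: (code_out_inj (W := hull (A, u))) => //.
    - exact: subsetUr.
    - by rewrite hh; exact: subsetUr.
    - by rewrite hA.
    - by rewrite hh hA'.
    - by rewrite hw hh.
  by rewrite -hA -hA' hh uu.
apply/subset_leq_card/subsetP => z /imsetP[t tP ->]; exact: code_sub.
Qed.

End StableSetsAndEdges.

(** * Ideals and Hasse edges of a finite order *)

Section EdgeCount.
Variables (X : finType) (G : {set {set X}}).
Hypotheses (rG : set_ring G) (sG : separating G).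

Let cov := ring_cover G.

Let cov_lt p q : cov p q -> ring_lt G p q. Proof. by case/andP. Qed.

Let cov_asym p q : cov p q -> ~~ cov q p.
Proof. by move/cov_lt/(ring_lt_asym sG); apply: contra => /cov_lt. Qed.

Let cov_gap p q r : cov p q -> ring_lt G p r -> ring_lt G r q -> False.
Proof. by move=> /andP[_ /forallP/(_ r)/negP h] pr rq; apply: h; rewrite pr. Qed.

(* in a triangle one cover would be refined by the other two edges *)
Let cov_triangle p q r : adj cov p q -> adj cov q r -> ~~ adj cov p r.
Proof.
have lt := cov_lt; have tr := @ring_lt_trans _ _ sG.
have cyc x y z : cov x y -> cov y z -> cov z x -> False.
  by move=> /lt xy /lt yz /lt zx; have := tr _ _ _ (tr _ _ _ xy yz) zx; rewrite /ring_lt eqxx.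
move=> /orP[] pq /orP[] qr; apply/negP => /orP[] pr.
- exact: cov_gap pr (lt _ _ pq) (lt _ _ qr).
- exact: cyc pq qr pr.
- exact: cov_gap pq (lt _ _ pr) (lt _ _ qr).
- exact: cov_gap qr (lt _ _ pr) (lt _ _ pq).
- exact: cov_gap qr (lt _ _ pq) (lt _ _ pr).
- exact: cov_gap pq (lt _ _ qr) (lt _ _ pr).
- exact: cyc pq pr qr.
- exact: cov_gap pr (lt _ _ qr) (lt _ _ pq).
Qed.

Let N := [set p | ~~ (ring_min G p && ring_max G p)].

Let cov_N p q : cov p q -> p \in N /\ q \in N.
Proof.
move=> /cov_lt pq; rewrite !inE; split; apply/negP => /andP[/forallP mn /forallP mx].
  by have := mx q; rewrite pq.
by have := mn p; rewrite pq.
Qed.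

Let tops (A : {set X}) := [set p in A | [forall q in A, ~~ ring_lt G p q]].

(* an ideal is generated by its maximal elements *)
Let tops_inj : {in G &, injective tops}.
Proof.
have below (A : {set X}) p : p \in A -> exists2 q, q \in tops A & ring_le G p q.
  move=> pA; pose up q := #|[set t | ring_le G q t]|.
  pose Q := [pred q in A | ring_le G p q].
  have Qp : Q p by rewrite /= pA ring_le_refl.
  case: (@arg_minnP _ p Q up Qp) => q /andP[qA pq] qmin; exists q => //.
  rewrite inE qA; apply/forall_inP => r rA; apply/negP => qr.
  have /andP[_ le_qr] := qr.
  have := qmin r; rewrite /= rA (ring_le_trans pq le_qr) => /(_ isT).
  apply/negP; rewrite -ltnNge; apply: proper_card; apply/properP; split.
    by apply/subsetP => u; rewrite !inE; apply: ring_le_trans.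
  exists q; rewrite !inE ?ring_le_refl //.
  by apply/negP => rq; move: (ring_le_lt_trans sG rq qr); rewrite /ring_lt eqxx.
move=> A B GA GB h; apply/eqP; rewrite eqEsubset; apply/andP; split; apply/subsetP => p.
  move=> /below[q]; rewrite h inE => /andP[qB _] pq; exact: ring_ideal pq qB.
move=> /below[q]; rewrite -h inE => /andP[qB _] pq; exact: ring_ideal pq qB.
Qed.

Let card_ring_cov : #|G| * #|[set u : X * X | cov u.1 u.2]| <= #|N| * 2 ^ #|X|.
Proof.
apply: leq_trans (stable_edge_bound cov_asym cov_triangle cov_N).
rewrite leq_mul2r; apply/orP; right; rewrite -(card_in_imset tops_inj).
apply/subset_leq_card/subsetP => _ /imsetP[A GA ->]; rewrite inE.
apply/forall_inP => p; rewrite inE => /andP[pA /forall_inP pmax].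
apply/forall_inP => q; rewrite inE => /andP[qA _].
by apply: contra (pmax q qA); apply: cov_lt.
Qed.

Let card_min_max :
  #|[set p | ring_min G p]| + #|[set p | ring_max G p]| <= #|N| + (#|X| - #|N|).*2.
Proof.
rewrite -cardsUI.
have -> : [set p | ring_min G p] :&: [set p | ring_max G p] = ~: N.
  by apply/setP => p; rewrite !inE negbK.
have cN := cardsC N; rewrite -cN addKn -addnn addnA cN leq_add2r.
exact: max_card.
Qed.

(** The edges of the Hasse diagram after a least and a greatest element have been
    added, for a nonempty order. *)
Definition num_edges : nat :=
  #|[set p | ring_min G p]| + #|[set p | ring_max G p]|
  + #|[set u : X * X | ring_cover G u.1 u.2]|.

Let card_G : #|G| <= 2 ^ #|X|.
Proof. by rewrite -cardsT -card_powerset powersetT; apply/subset_leq_card/subsetT. Qed.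

(* equality holds for a = 2 ^ #|X| *)
Let sum_le (a : nat) : a <= 2 ^ #|X| ->
  a * (#|N| + (#|X| - #|N|).*2) + #|N| * 2 ^ #|X| <= #|X| * 2 ^ #|X|.+1.
Proof.
move=> le_a; have le : #|N| <= #|X| by apply: max_card.
have -> : #|X| * 2 ^ #|X|.+1 =
    2 ^ #|X| * (#|N| + (#|X| - #|N|).*2) + #|N| * 2 ^ #|X|.
  by rewrite expnS [#|N| * _]mulnC -mulnDr mulnCA mulnA [RHS]mulnC; congr (_ * _); lia.
by rewrite leq_add2r leq_mul2r le_a orbT.
Qed.

Let ring_edges_card : #|G| * num_edges <=
  #|G| * (#|N| + (#|X| - #|N|).*2) + #|N| * 2 ^ #|X|.
Proof.
rewrite /num_edges mulnDr leq_add ?card_ring_cov //.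
by rewrite leq_mul2l card_min_max orbT.
Qed.

Lemma ring_edges_le : #|G| * num_edges <= #|X| * 2 ^ #|X|.+1.
Proof. exact: leq_trans ring_edges_card (sum_le card_G). Qed.

Lemma ring_edges_eq :
  #|G| * num_edges = #|X| * 2 ^ #|X|.+1 -> G = [set: {set X}].
Proof.
move=> eqE; apply/eqP; rewrite eqEcard subsetT /= leqNgt.
rewrite -powersetT card_powerset cardsT; apply/negP => ltG.
have X0 : 0 < #|X|.
  rewrite lt0n; apply/eqP => X0; have [G0 _ _ _] := rG.
  by move: ltG; rewrite X0 ltnS leqn0 cards_eq0 => /eqP G_eq0; rewrite G_eq0 inE in G0.
have le : #|N| <= #|X| by apply: max_card.
have := leq_trans (sum_le ltG) (eq_leq (esym eqE)).
move=> /leq_trans/(_ ring_edges_card); rewrite mulSn leq_add2r -{2}[#|G| * _]add0n leq_add2r.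
by lia.
Qed.
End EdgeCount.

(** * Reduction of a ring of sets to a separating one *)

Section RingQuotient.
Variables (E : finType) (D : {set {set E}}).
Hypothesis D_neq0 : D != set0.
Hypothesis DI : forall S T, S \in D -> T \in D -> S :&: T \in D.
Hypothesis DU : forall S T, S \in D -> T \in D -> S :|: T \in D.

(** Stated by counting, which includes disjointness of the blocks and turns into a
    sum of indicator vectors. *)
Definition decomposes k (B0 : {set E}) (B : 'I_k -> {set E}) (S : {set E}) (A : {set 'I_k}) :=
  forall e, (e \in S) = (e \in B0) + \sum_(i in A) (e \in B i) :> nat.

(** Points lying in the same members of D form a block, and each member is a
    disjoint union of blocks.  B0 is the block of the points lying in all members,
    the B i are the blocks of the points lying in some but not all of them. *)
Lemma ring_quotient :
  exists k (G : {set {set 'I_k}}) (a : 'I_k -> E) (B0 : {set E}) (B : 'I_k -> {set E}),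
    [/\ set_ring G /\ separating G,
        forall i, a i \notin B0, forall i j, (a i \in B j) = (i == j),
        forall S, S \in D -> exists2 A, A \in G & decomposes B0 B S A
      & forall A, A \in G -> exists2 S, S \in D & decomposes B0 B S A].
Proof.
pose sig (e : E) := [set S in D | e \in S].
pose K := [set sig e | e in E] :\: [set set0; D].
pose key (i : 'I_#|K|) := enum_val i.
have keyK i : key i \in K by apply: enum_valP.
have key_neqD i : key i != D by have := keyK i; rewrite !inE negb_or => /andP[/andP[]].
have key_neq0 i : key i != set0 by have := keyK i; rewrite !inE negb_or => /andP[/andP[]].
have [a sig_a] : exists a, forall i, sig (a i) = key i.
  by apply: (@fin_all_exists _ _ (fun i e => sig e = key i)) => i;
    have := keyK i; rewrite inE => /andP[_ /imsetP[e _ ->]]; exists e.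
have mem_a i (S : {set E}) : S \in D -> (a i \in S) = (S \in key i).
  by move=> DS; rewrite -sig_a inE DS.
pose B0 := [set e | sig e == D]; pose B i := [set e | sig e == key i].
pose tr (S : {set E}) := [set i | a i \in S].
have dec (S : {set E}) : S \in D -> decomposes B0 B S (tr S).
  move=> DS e; have eS : (e \in S) = (S \in sig e) by rewrite inE DS.
  have B0E : (e \in B0) = (sig e == D) by rewrite inE.
  have BE i : (e \in B i) = (sig e == key i) by rewrite inE.
  rewrite eS B0E; under eq_bigr => i _ do rewrite BE.
  have [eD|neD] := eqVneq (sig e) D.
    by rewrite eD DS big1 // => i _; rewrite eq_sym (negbTE (key_neqD i)).
  have [e0|ne0] := eqVneq (sig e) set0.
    by rewrite e0 inE big1 // => i _; rewrite eq_sym (negbTE (key_neq0 i)).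
  have eK : sig e \in K by rewrite !inE negb_or ne0 neD imset_f.
  have keyr : key (enum_rank_in eK (sig e)) = sig e by apply: enum_rankK_in.
  move: (enum_rank_in eK (sig e)) keyr => r keyr; rewrite -keyr add0n big_mkcond.
  rewrite (bigD1 r) //= inE mem_a // eqxx big1 ?addn0; first by case: (S \in key r).
  by move=> i nir; rewrite (inj_eq enum_val_inj) eq_sym (negbTE nir) if_same.
have D_cap : \bigcap_(S in D) S \in D.
  have [S0 DS0] := set0Pn _ D_neq0.
  have -> : \bigcap_(S in D) S = \bigcap_(S in D) (S0 :&: S).
    apply/setP => e; apply/bigcapP/bigcapP => h S DS.
      by rewrite inE !h.
    by have := h S DS; rewrite inE => /andP[].
  have : (\bigcap_(S in D) (S0 :&: S) == setT) || (\bigcap_(S in D) (S0 :&: S) \in D).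
    elim/big_ind: _ => [|S T|S DS]; rewrite ?eqxx //; last by rewrite DI ?orbT.
    case/orP=> [/eqP->|DS]; first by rewrite setTI.
    by case/orP=> [/eqP->|DT]; rewrite ?setIT ?DS ?DI ?orbT.
  case/orP=> [/eqP h|//]; rewrite h; suff <- : S0 = setT by [].
  apply/eqP; rewrite -subTset -h; apply/subsetP => e /bigcapP/(_ S0 DS0).
  by rewrite setIid.
have D_cup : \bigcup_(S in D) S \in D.
  have [S0 DS0] := set0Pn _ D_neq0.
  have -> : \bigcup_(S in D) S = \bigcup_(S in D) (S0 :|: S).
    apply/setP => e; apply/bigcupP/bigcupP => -[S DS eS].
      by exists S; rewrite // inE eS orbT.
    by case/setUP: eS; [exists S0 | exists S].
  have : (\bigcup_(S in D) (S0 :|: S) == set0) || (\bigcup_(S in D) (S0 :|: S) \in D).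
    elim/big_ind: _ => [|S T|S DS]; rewrite ?eqxx //; last by rewrite DU ?orbT.
    case/orP=> [/eqP->|DS]; first by rewrite set0U.
    by case/orP=> [/eqP->|DT]; rewrite ?setU0 ?DS ?DU ?orbT.
  case/orP=> [/eqP h|//]; rewrite h; suff <- : S0 = set0 by [].
  apply/eqP; rewrite -subset0 -h; apply/subsetP => e eS0.
  by apply/bigcupP; exists S0; rewrite // setUid.
exists #|K|, [set tr S | S in D], a, B0, B; split.
- split; first split.
  + apply/imsetP; exists (\bigcap_(S in D) S) => //; apply/setP => i; rewrite !inE.
    apply/esym/negP => /bigcapP ai; case/eqP: (key_neqD i).
    apply/setP => S; rewrite -sig_a inE andb_idr // => DS; exact: ai.
  + apply/imsetP; exists (\bigcup_(S in D) S) => //; apply/setP => i; rewrite !inE.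
    have [S Si] := set0Pn _ (key_neq0 i); apply/esym/bigcupP; exists S.
      by move: Si; rewrite -sig_a inE => /andP[].
    by move: Si; rewrite -sig_a inE => /andP[].
  + move=> _ _ /imsetP[S DS ->] /imsetP[T DT ->]; apply/imsetP.
    by exists (S :&: T); [apply: DI | apply/setP => i; rewrite !inE].
  + move=> _ _ /imsetP[S DS ->] /imsetP[T DT ->]; apply/imsetP.
    by exists (S :|: T); [apply: DU | apply/setP => i; rewrite !inE].
  move=> p q h; apply: enum_val_inj; rewrite -/(key p) -/(key q).
  apply/setP => S; have [DS|nDS] := boolP (S \in D); last first.
    by rewrite -!sig_a !inE (negbTE nDS).
  by rewrite -!mem_a //; have := h (tr S); rewrite !inE; apply; apply: imset_f.
- by move=> i; rewrite inE sig_a.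
- by move=> i j; rewrite inE sig_a (inj_eq enum_val_inj).
- by move=> S DS; exists (tr S); [apply: imset_f | apply: dec].
- by move=> _ /imsetP[S DS ->]; exists S => //; apply: dec.
Qed.

End RingQuotient.

(** * The lattice of stable matchings *)

Section StableLattice.

Definition swap_sides (M W : finType) (I : marriage_instance M W) : marriage_instance W M :=
  MarriageInstance (ltW_order I) (ltM_order I).

(** Carrying the inverse h along makes the notion symmetric in the two sides. *)
Definition stable_pair (M W : finType) (I : marriage_instance M W)
    (f : M -> W) (h : W -> M) : Prop :=
  [/\ cancel f h, cancel h f
    & forall m w, f m != w -> ltM I m w (f m) || Defs.ltW I w m (h w)].

Definition better_partner (M W : finType) (I : marriage_instance M W) (f g : M -> W) m :=
  if ltM I m (f m) (g m) then g m else f m.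

Definition worse_partner (M W : finType) (I : marriage_instance M W) (f g : M -> W) m :=
  if ltM I m (f m) (g m) then f m else g m.

Definition matching_of (M W : finType) (f : M -> W) : {set M * W} := [set e | f e.1 == e.2].

Lemma stable_pair_swap (M W : finType) (I : marriage_instance M W) f h :
  stable_pair I f h -> stable_pair (swap_sides I) h f.
Proof.
move=> [fK hK st]; split=> // w m nw; rewrite orbC; apply: st.
by apply: contra nw => /eqP <-; rewrite fK.
Qed.

Section Join.
Variables (M W : finType) (I : marriage_instance M W).

Let ltM_irr m w : ltM I m w w = false.
Proof. by have [h _ _] := ltM_order I m; apply: h. Qed.
Let ltM_asym m w w' : ltM I m w w' -> ltM I m w' w = false.
Proof.
have [irr tr _] := ltM_order I m => h; apply/negP => h'.
by have := tr _ _ _ h h'; rewrite irr.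
Qed.
Let ltM_trans m : transitive (ltM I m). Proof. by have [] := ltM_order I m. Qed.
Let ltM_total m w w' : w != w' -> ltM I m w w' || ltM I m w' w.
Proof. by have [_ _ h] := ltM_order I m; apply: h. Qed.

(** The pair (m, g m) does not block f, and m would gain by it. *)
Lemma opposite_interest f h g k m :
  stable_pair I f h -> stable_pair I g k -> ltM I m (f m) (g m) ->
  Defs.ltW I (g m) m (h (g m)).
Proof.
move=> [_ _ st] _ lt; have : f m != g m by apply: contraTneq lt => ->; rewrite ltM_irr.
by move/st; rewrite ltM_asym.
Qed.

(** By opposition of interests the women get the worse of their two partners.  A
    pair that blocks the join would therefore block f or g. *)
Lemma join_stable f h g k : #|M| = #|W| ->
  stable_pair I f h -> stable_pair I g k ->
  stable_pair I (better_partner I f g) (worse_partner (swap_sides I) h k).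
Proof.
move=> cMW sf sg; have [fK hK fst] := sf; have [gK kK gst] := sg.
have ltW_asym w m m' : Defs.ltW I w m m' -> Defs.ltW I w m' m = false.
  have [irr tr _] := ltW_order I w => lt; apply/negP => lt'.
  by have := tr _ _ _ lt lt'; rewrite irr.
have JK : cancel (better_partner I f g) (worse_partner (swap_sides I) h k).
  move=> m; rewrite /better_partner; case: ifPn => [lt|nlt]; rewrite /worse_partner /=.
    by have := opposite_interest sf sg lt; rewrite gK => /ltW_asym ->.
  have [fg|nfg] := eqVneq (f m) (g m); first by rewrite fK fg gK; case: ifP.
  have lt : ltM I m (g m) (f m) by have := ltM_total m nfg; rewrite (negbTE nlt).
  by have := opposite_interest sg sf lt; rewrite fK => ->.
(* a one-sided inverse suffices, as both sides have the same size *)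
have [J' J'K JK'] : bijective (better_partner I f g).
  by apply: inj_card_bij (can_inj JK) _; rewrite cMW.
split=> // [w|m w nw]; first by rewrite -{1}[w]JK' JK JK'.
have [//|/= nlt] := boolP (ltM I m w (better_partner I f g m)).
have lt : ltM I m (better_partner I f g m) w.
  by have := ltM_total m nw; rewrite (negbTE nlt) orbF.
have [ltf ltg] : ltM I m (f m) w /\ ltM I m (g m) w.
  move: lt; rewrite /better_partner; case: ifPn => [lt lt'|nlt' lt'].
    by split=> //; apply: ltM_trans lt lt'.
  split=> //; have [<-//|nfg] := eqVneq (f m) (g m).
  by apply: ltM_trans lt'; have := ltM_total m nfg; rewrite (negbTE nlt').
have fw : f m != w by apply: contraTneq ltf => ->; rewrite ltM_irr.
have gw : g m != w by apply: contraTneq ltg => ->; rewrite ltM_irr.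
have := fst _ _ fw; have := gst _ _ gw; rewrite ltM_asym // [ltM I m w (f m)]ltM_asym //=.
by rewrite /worse_partner; case: ifP.
Qed.

End Join.

Variables (M W : finType) (I : marriage_instance M W).
Hypothesis cardMW : #|M| = #|W|.

(** The meet for one side is the join for the other side. *)
Lemma meet_stable f h g k :
  stable_pair I f h -> stable_pair I g k ->
  stable_pair I (worse_partner I f g) (better_partner (swap_sides I) h k).
Proof.
move=> /stable_pair_swap sf /stable_pair_swap sg.
by have [hK fK st] := stable_pair_swap (join_stable (esym cardMW) sf sg); split.
Qed.

Let card_mkset (T : finType) (p : pred T) :
  #|mkset (fun x => p x)| = #|[set x | p x]|.
Proof.
by apply: eq_card => x; rewrite inE; apply/idP/idP; rewrite in_setE.
Qed.

Lemma stable_matching_pair mu : stable_matching I mu ->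
  exists f h, stable_pair I f h /\ mu = matching_of f.
Proof.
case/andP=> /andP[/forallP wives /forallP husbands] /forallP st.
have {}wives m : #|[set w | (m, w) \in mu]| == 1.
  by rewrite -(eqP (wives m)) card_mkset.
have {}husbands w : #|[set m | (m, w) \in mu]| == 1.
  by rewrite -(eqP (husbands w)) card_mkset.
have [f fE] : exists f : M -> W, forall m, [set w | (m, w) \in mu] = [set f m].
  apply: (@fin_all_exists _ _ (fun m w => [set w | (m, w) \in mu] = [set w])) => m.
  exact/cards1P.
have [h hE] : exists h : W -> M, forall w, [set m | (m, w) \in mu] = [set h w].
  apply: (@fin_all_exists _ _ (fun w m => [set m | (m, w) \in mu] = [set m])) => w.
  exact/cards1P.
have muf m w : ((m, w) \in mu) = (f m == w).
  by have /setP/(_ w) := fE m; rewrite !inE eq_sym.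
have muh m w : ((m, w) \in mu) = (h w == m).
  by have /setP/(_ m) := hE w; rewrite !inE eq_sym.
exists f, h; split; last by apply/setP => -[m w]; rewrite inE muf.
split=> [m|w|m w nw].
- by apply/eqP; rewrite -muh muf.
- by apply/eqP; rewrite -muf muh.
have /forallP/(_ w)/implyP := st m; rewrite muf => /(_ nw)/orP[] /existsP[x /andP[]].
  by rewrite muh => /eqP-> ->; rewrite orbT.
by rewrite muf => /eqP-> ->.
Qed.

Lemma stable_pair_matching f h : stable_pair I f h -> stable_matching I (matching_of f).
Proof.
move=> [fK hK st]; apply/andP; split; first (apply/andP; split).
- apply/forallP => m; rewrite card_mkset; apply/cards1P; exists (f m).
  by apply/setP => w; rewrite !inE eq_sym.
- apply/forallP => w; rewrite card_mkset; apply/cards1P; exists (h w).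
  by apply/setP => m; rewrite !inE /=; apply/eqP/eqP => [<-|->].
apply/forallP => m; apply/forallP => w; apply/implyP; rewrite inE /= => /st/orP[lt|lt].
  by apply/orP; right; apply/existsP; exists (f m); rewrite inE eqxx.
by apply/orP; left; apply/existsP; exists (h w); rewrite inE /= hK eqxx.
Qed.

Definition leM m w w' := (w == w') || ltM I m w w'.

(** This encoding turns the join and meet of matchings into union and
    intersection. *)
Definition profile (mu : {set M * W}) : {set M * W} :=
  [set e | [exists w, ((e.1, w) \in mu) && leM e.1 e.2 w]].

Lemma profile_matching_of f e : (e \in profile (matching_of f)) = leM e.1 e.2 (f e.1).
Proof.
rewrite inE; apply/existsP/idP => [[w]|h]; first by rewrite inE => /andP[/eqP ->].
by exists (f e.1); rewrite inE eqxx.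
Qed.

Definition profiles : {set {set M * W}} := [set profile mu | mu in stable_matching I].

Let leM_trans m w1 w2 w3 : leM m w1 w2 -> ltM I m w2 w3 -> leM m w1 w3.
Proof.
have [_ tr _] := ltM_order I m.
by case/orP=> [/eqP->|h1 h2]; rewrite /leM; [move->|rewrite (tr _ _ _ h1 h2)]; rewrite orbT.
Qed.

Let max_min f g m : ltM I m (f m) (g m) \/ leM m (g m) (f m).
Proof.
have [_ _ tot] := ltM_order I m; rewrite /leM eq_sym.
by have [->|/tot/orP[]] := eqVneq (f m) (g m); [right|left|right].
Qed.

Lemma profilesU S T : S \in profiles -> T \in profiles -> S :|: T \in profiles.
Proof.
case/imsetP=> mu /stable_matching_pair[f [h [sf ->]]] ->.
case/imsetP=> nu /stable_matching_pair[g [k [sg ->]]] ->.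
apply/imsetP; exists (matching_of (better_partner I f g)).
  exact: stable_pair_matching (join_stable cardMW sf sg).
apply/setP => e; rewrite inE !profile_matching_of /better_partner.
case: ifPn => [lt|nlt]; apply/orP/idP => [[|]|] h1 //; try by [left | right].
  exact: leM_trans h1 lt.
have [lt|] := max_min f g e.1; first by rewrite lt in nlt.
by case/orP=> [/eqP <-//|lt]; apply: leM_trans lt.
Qed.

Lemma profilesI S T : S \in profiles -> T \in profiles -> S :&: T \in profiles.
Proof.
case/imsetP=> mu /stable_matching_pair[f [h [sf ->]]] ->.
case/imsetP=> nu /stable_matching_pair[g [k [sg ->]]] ->.
apply/imsetP; exists (matching_of (worse_partner I f g)).
  exact: stable_pair_matching (meet_stable sf sg).
apply/setP => e; rewrite inE !profile_matching_of /worse_partner.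
case: ifPn => [lt|nlt]; apply/andP/idP => [[]|h1] //; split=> //.
  exact: leM_trans h1 lt.
have [lt|] := max_min f g e.1; first by rewrite lt in nlt.
by case/orP=> [/eqP <-//|lt]; apply: leM_trans lt.
Qed.

End StableLattice.

(** * Convex hulls, dimension and facets *)

Section Hulls.
Local Open Scope classical_set_scope.
Local Open Scope ring_scope.
Variables (R : realType) (V : vectType R).
Implicit Types (A P F : set V) (c l : {linear V -> R^o}) (b : R) (U : {vspace V}).

Lemma sub_conv_hull A : A `<=` conv_hull A.
Proof.
move=> x Ax; exists 1%N, (fun=> x), (fun=> 1); split=> //.
- by rewrite big_ord1.
- by rewrite big_ord1 scale1r.
Qed.

Lemma conv_hull_affine A c b :
  (forall x, A x -> c x = b) -> forall x, conv_hull A x -> c x = b.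
Proof.
move=> cA x [k [p [a [Ap _ a1 ->]]]]; rewrite linear_sum /=.
under eq_bigr => i _ do rewrite linearZ /= cA //.
by rewrite -scaler_suml a1 scale1r.
Qed.

Lemma conv_hull_le A c b :
  (forall x, A x -> c x <= b) -> forall x, conv_hull A x -> c x <= b.
Proof.
move=> cA x [k [p [a [Ap a0 a1 ->]]]]; rewrite linear_sum /=.
rewrite -[leRHS]mul1r -a1 mulr_suml; apply: ler_sum => i _.
by rewrite linearZ /=; apply: ler_wpM2l => //; apply: cA.
Qed.

(** A point of a convex hull that maximises c is a combination of maximisers, as
    any other point of positive weight would lower the value. *)
Lemma conv_hull_argmax A c b x :
    (forall y, A y -> c y <= b) -> conv_hull A x -> c x = b ->
  conv_hull (A `&` [set y | c y = b]) x.
Proof.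
move=> cA [k [p [a [Ap a0 a1 ->]]]] cx.
have tight i : a i != 0 -> c (p i) = b.
  have : \sum_i a i * (b - c (p i)) = 0.
    under eq_bigr => j _ do rewrite mulrBr.
    rewrite sumrB -mulr_suml a1 mul1r -[X in X - _]cx linear_sum /=; apply/eqP.
    by rewrite subr_eq0; apply/eqP/eq_bigr => j _; rewrite linearZ.
  move/eqP; rewrite psumr_eq0 => [/allP/(_ i)|j _].
    rewrite mem_index_enum => /(_ isT); rewrite mulf_eq0 => /orP[->//|].
    by rewrite subr_eq0 => /eqP.
  by rewrite mulr_ge0 // subr_ge0 cA.
have [i0 ai0] : exists i, a i != 0.
  apply/existsP; apply: contraT => /existsPn h; move: a1.
  rewrite big1 => [/eqP|i _]; first by rewrite eq_sym oner_eq0.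
  by apply/eqP; have := h i; rewrite negbK.
exists k, (fun i => if a i == 0 then p i0 else p i), a; split => //.
  by move=> i; case: ifPn => ai; split => //=; apply: tight.
by apply: eq_bigr => i _; case: ifPn => // /eqP->; rewrite !scale0r.
Qed.

Lemma sub_aff_hull A : A `<=` aff_hull A.
Proof.
move=> x Ax; exists 1%N, (fun=> x), (fun=> 1); split=> //.
- by rewrite big_ord1.
- by rewrite big_ord1 scale1r.
Qed.

Lemma aff_hullS A F : A `<=` F -> aff_hull A `<=` aff_hull F.
Proof. by move=> AF x [k [p [a [Ap a1 ->]]]]; exists k, p, a; split=> // i; apply: AF. Qed.

Lemma aff_hull_nonempty A x : aff_hull A x -> A !=set0.
Proof.
move=> [k [p [a [Ap a1 _]]]]; case: k p a Ap a1 => [|k] p a Ap a1.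
  by move: a1; rewrite big_ord0 => /eqP; rewrite eq_sym oner_eq0.
by exists (p ord0).
Qed.

Lemma aff_hull_affine A c b :
  (forall x, A x -> c x = b) -> forall x, aff_hull A x -> c x = b.
Proof.
move=> cA x [k [p [a [Ap a1 ->]]]]; rewrite linear_sum /=.
under eq_bigr => i _ do rewrite linearZ /= cA //.
by rewrite -scaler_suml a1 scale1r.
Qed.

Lemma aff_hull_dir A x0 U :
  (forall x, A x -> x - x0 \in U) -> forall x, aff_hull A x -> x - x0 \in U.
Proof.
move=> AU x [k [p [a [Ap a1 ->]]]].
rewrite -[x0]scale1r -a1 scaler_suml -sumrB.
by apply: rpred_sum => i _; rewrite -scalerBr rpredZ ?AU.
Qed.

Lemma conv_aff_hull A : conv_hull A `<=` aff_hull A.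
Proof. by move=> x [k [p [a [Ap _ a1 ->]]]]; exists k, p, a. Qed.

(** The weights of the q i are free because q0 takes up the rest. *)
Lemma aff_hull_comb A k (q : 'I_k -> V) (t : 'I_k -> R) q0 :
  A q0 -> (forall i, A (q i)) -> aff_hull A (q0 + \sum_i t i *: (q i - q0)).
Proof.
move=> Aq0 Aq.
exists k.+1, (fun i => if unlift ord0 i is Some j then q j else q0),
  (fun i => if unlift ord0 i is Some j then t j else 1 - \sum_j t j); split.
- by move=> i; case: unliftP => [j|] _.
- rewrite big_ord_recl unlift_none.
  by under [X in _ + X]eq_bigr => i _ do rewrite liftK; rewrite subrK.
- rewrite big_ord_recl unlift_none.
  under [X in _ = _ + X]eq_bigr => i _ do rewrite liftK.
  under [X in _ + X = _]eq_bigr => i _ do rewrite scalerBr.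
  by rewrite sumrB -scaler_suml scalerBl scale1r addrA addrAC.
Qed.

Lemma has_dim_base A d x0 : has_dim A d -> A x0 ->
  exists2 U : {vspace V}, aff_hull A = [set x | x - x0 \in U] & \dim U = d.
Proof.
move=> [x1 [U [hA dU]]] /sub_aff_hull; rewrite hA /= => x01; exists U => //.
apply/seteqP; split => x /= h.
  by rewrite -(subrKA x1) -[x1 - x0]opprB rpredB.
by rewrite -(subrKA x0) rpredD.
Qed.

Lemma has_dim_nonempty A d : has_dim A d -> A !=set0.
Proof.
move=> [x0 [U [hA _]]]; apply: (@aff_hull_nonempty _ x0).
by rewrite hA /= subrr rpred0.
Qed.

Lemma has_dim_uniq A d d' : has_dim A d -> has_dim A d' -> d = d'.
Proof.
move=> hd hd'; have [x0 Ax0] := has_dim_nonempty hd.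
have [U hU <-] := has_dim_base hd Ax0; have [U' hU' <-] := has_dim_base hd' Ax0.
congr (\dim _); apply/vspaceP => u.
have : [set x | x - x0 \in U] (u + x0) = [set x | x - x0 \in U'] (u + x0).
  by rewrite -hU hU'.
by rewrite /= addrK => e; apply/idP/idP; rewrite e.
Qed.

Lemma has_dim_set1 (x : V) : has_dim [set x] 0.
Proof.
exists x, 0%VS; rewrite dimv0; split=> //; apply/seteqP; split => y /=.
  by apply: aff_hull_dir => z ->; rewrite subrr rpred0.
by rewrite memv0 subr_eq0 => /eqP->; apply: sub_aff_hull.
Qed.

Lemma has_dim0 A : has_dim A 0 -> exists x, A = [set x].
Proof.
move=> h; have [x Ax] := has_dim_nonempty h; exists x.
have [U hA /eqP] := has_dim_base h Ax; rewrite dimv_eq0 => /eqP U0.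
apply/seteqP; split=> [y /sub_aff_hull|_ ->//].
by rewrite hA /= U0 memv0 subr_eq0 => /eqP.
Qed.

Lemma aff_hull_linear0 A x0 U c b :
  aff_hull A = [set x | x - x0 \in U] -> (forall x, A x -> c x = b) ->
  forall u, u \in U -> c u = 0.
Proof.
move=> hA cA u uU; have cb := aff_hull_affine cA.
have cx0 : c x0 = b by apply: cb; rewrite hA /= subrr rpred0.
have : c (u + x0) = b by apply: cb; rewrite hA /= addrK.
by rewrite raddfD /= cx0 => /(canRL (addrK _)); rewrite subrr.
Qed.

Lemma proper_kernel_dim U U' c y k :
  (U' <= U)%VS -> (forall u, u \in U' -> c u = 0) -> \dim U = k.+1 ->
  y \in U -> c y != 0 -> (\dim U' <= k)%N.
Proof.
move=> sUU' cU' dU yU cy; rewrite -ltnS -dU.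
rewrite ltn_neqAle dimvS // andbT; apply: contra cy => dUU'.
have e : U' == U by rewrite eqEdim sUU' (eqP dUU') leqnn.
by apply/eqP/cU'; rewrite (eqP e).
Qed.

(** Both sets span the same hyperplane of the affine hull of P, so the functional
    that supports F is constant on the section. *)
Lemma facet_eq_section P c b l beta k :
    let F := [set x | P x /\ c x = b] in
    has_dim P k.+1 -> has_dim F k ->
    (forall x, F x -> l x = beta) -> (exists2 y, P y & l y != beta) ->
  F = [set x | P x /\ l x = beta].
Proof.
move=> F dP dF lF [y Py ly]; apply/seteqP; split=> x [Px cx].
  by split=> //; apply: lF.
split=> //; have [x0 Fx0] := has_dim_nonempty dF.
have [U hU dU] := has_dim_base dP (proj1 Fx0).
have [U' hU' dU'] := has_dim_base dF Fx0.
have sUU' : (U' <= U)%VS.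
  apply/subvP => u uU'; have : aff_hull F (u + x0) by rewrite hU' /= addrK.
  have sFP : F `<=` P by move=> z [].
  by move/(aff_hullS sFP); rewrite hU /= addrK.
have l0 := aff_hull_linear0 hU' lF.
pose L := linfun l; pose K := (U :&: lker L)%VS.
have KE u : (u \in K) = (u \in U) && (l u == 0) by rewrite memv_cap memv_ker lfunE.
have inU z : P z -> z - x0 \in U by move/sub_aff_hull; rewrite hU.
have UK : U' = K.
  apply/eqP; rewrite eqEdim dU'; apply/andP; split.
    by apply/subvP => u uU'; rewrite KE l0 // eqxx andbT (subvP sUU').
  apply: (@proper_kernel_dim U K l (y - x0)); rewrite ?capvSl ?inU //.
    by move=> u; rewrite KE => /andP[_ /eqP].
  by rewrite raddfB /= (lF _ Fx0) subr_eq0.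
have : x - x0 \in U' by rewrite UK KE inU // raddfB /= cx (lF _ Fx0) subrr eqxx.
move/(aff_hull_linear0 hU' (c := c) (b := b)).
have -> : c x = c (x - x0) + c x0 by rewrite -raddfD subrK.
by rewrite (proj2 Fx0) => -> //; rewrite ?add0r // => z [].
Qed.

(** The k + 1 points fix the dimension from below, and the point y off the
    supporting hyperplane bounds it from above. *)
Lemma has_dim_facet P c b k (q : 'I_k -> V) q0 y :
    let F := [set x | P x /\ c x = b] in
    has_dim P k.+1 -> F q0 -> (forall i, F (q i)) -> P y -> c y != b ->
    (forall t : 'I_k -> R, \sum_i t i *: (q i - q0) = 0 -> forall i, t i = 0) ->
  has_dim F k.
Proof.
move=> F dP Fq0 Fq Py cy free_q; have [U hU dU] := has_dim_base dP (proj1 Fq0).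
pose L := linfun c; pose K := (U :&: lker L)%VS.
have KE u : (u \in K) = (u \in U) && (c u == 0) by rewrite memv_cap memv_ker lfunE.
have inU z : P z -> z - q0 \in U by move/sub_aff_hull; rewrite hU.
have inK z : F z -> z - q0 \in K.
  by move=> [Pz cz]; rewrite KE inU // raddfB /= cz (proj2 Fq0) subrr eqxx.
have dK : (\dim K <= k)%N.
  apply: (@proper_kernel_dim U K c (y - q0)); rewrite ?capvSl ?inU //.
    by move=> u; rewrite KE => /andP[_ /eqP].
  by rewrite raddfB /= (proj2 Fq0) subr_eq0.
pose s := [tuple q i - q0 | i < k].
have free_s : free s.
  apply/freeP => t ht; apply: free_q; rewrite -{}[RHS]ht.
  by apply: eq_bigr => i _; rewrite (nth_mktuple (fun i => q i - q0) 0 i).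
have sK : (<<s>> <= K)%VS.
  by apply/span_subvP => _ /mapP[i _ ->]; apply: inK.
have dS : \dim <<s>> = k by have := free_s; rewrite /free => /eqP->; rewrite size_tuple.
have KS : K = <<s>>%VS by apply/esym/eqP; rewrite eqEdim sK dS.
exists q0, K; split; last by rewrite KS.
apply/seteqP; split=> x; first exact: aff_hull_dir.
rewrite /= KS => /coord_span xE.
rewrite -[x](subrK q0) addrC xE.
under eq_bigr => i _ do rewrite (nth_mktuple (fun i => q i - q0) 0 i).
exact: aff_hull_comb.
Qed.

End Hulls.

(** * Polytopes of rings of sets *)

Lemma card_fset_set_le (T : choiceType) (A : set T) (s : seq T) :
  (forall x, A x -> x \in s) -> finite_set A /\ (#|` fset_set A| <= size s)%N.
Proof.
move=> As; have finA : finite_set A by apply: sub_finite_set (finite_seq s).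
split=> //; apply: uniq_leq_size => [|x]; first exact: fset_uniq.
by rewrite in_fset_set // => /set_mem/As.
Qed.

Lemma card_fset_set_ge (T : choiceType) (I : finType) (A : set T) (h : I -> T) :
  finite_set A -> injective h -> (forall i, A (h i)) -> (#|I| <= #|` fset_set A|)%N.
Proof.
move=> finA inj_h Ah; rewrite cardE -(size_map h); apply: uniq_leq_size.
  by rewrite map_inj_uniq ?enum_uniq.
by move=> _ /mapP[i _ ->]; rewrite in_fset_set //; apply/mem_set.
Qed.

Section RingPolytope.
Local Open Scope classical_set_scope.
Local Open Scope ring_scope.
Variables (R : realType) (V : vectType R) (d : nat) (G : {set {set 'I_d}}).
Variables (f0 : V) (g : 'I_d -> V) (phi : 'I_d -> {linear V -> R^o}).
Hypotheses (rG : set_ring G) (sG : separating G).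
(* phi p is the coordinate along g p; in particular the g p are independent *)
Hypothesis phi_f0 : forall p, phi p f0 = 0.
Hypothesis phi_g : forall p q, phi p (g q) = (p == q)%:R.

Definition ring_point (A : {set 'I_d}) : V := f0 + \sum_(p in A) g p.

Definition ring_points : set V := [set x | exists2 A, A \in G & x = ring_point A].

Definition ring_polytope : set V := conv_hull ring_points.

Let P := ring_polytope.

Lemma phi_point p A : phi p (ring_point A) = (p \in A)%:R.
Proof.
rewrite raddfD /= phi_f0 add0r linear_sum /=.
have [pA|pA] := boolP (p \in A).
  rewrite (bigD1 p) //= phi_g eqxx big1 ?addr0 // => q /andP[_ /negbTE nqp].
  by rewrite phi_g eq_sym nqp.
by rewrite big1 // => q qA; rewrite phi_g; case: eqP => // pq; rewrite pq qA in pA.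
Qed.

Let point_P A : A \in G -> P (ring_point A).
Proof. by move=> GA; apply: sub_conv_hull; exists A. Qed.

Lemma ring_polytope_dim k : has_dim P k -> k = d.
Proof.
move=> hk; have P0 : P (ring_point set0) by apply: point_P; case: rG.
have [U hU <-] := has_dim_base hk P0.
pose s := [tuple g i | i < d].
have free_s : free s.
  apply/freeP => t ht i; have := congr1 (phi i) ht; rewrite linear0 linear_sum /= => <-.
  rewrite (bigD1 i) //= big1 ?addr0 => [|j /negbTE nji].
    by rewrite linearZ /= (nth_mktuple g 0 i) phi_g eqxx [_ *: _]mulr1.
  by rewrite linearZ /= (nth_mktuple g 0 j) phi_g eq_sym nji scaler0.
suff -> : U = <<s>>%VS.
  by move: free_s; rewrite /free => /eqP->; rewrite size_tuple.
have gs p : g p \in <<s>>%VS by apply/memv_span/map_f; rewrite mem_enum.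
apply/eqP; rewrite eqEsubv; apply/andP; split.
  apply/subvP => u uU; have : aff_hull P (u + ring_point set0) by rewrite hU /= addrK.
  move/(@aff_hull_dir _ _ _ (ring_point set0) <<s>>%VS); rewrite addrK; apply=> x.
  move/conv_aff_hull; apply: aff_hull_dir => _ [A GA ->].
  by rewrite /ring_point big_set0 addr0 addrC addKr rpred_sum // => p _; apply: gs.
apply/span_subvP => _ /mapP[p _ ->].
have [A [GA pA GA']] := principal_ideal rG sG p.
have -> : g p = ring_point A - ring_point (A :\ p).
  by rewrite /ring_point (big_setD1 p) //= opprD addrACA subrr add0r addrK.
have in_U B : B \in G -> ring_point B - ring_point set0 \in U.
  by move/point_P/sub_aff_hull; rewrite hU.
rewrite -(subrKA (ring_point set0)) -[X in _ + X]opprB.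
by rewrite rpredB ?in_U.
Qed.

Let face_point (c : {linear V -> R^o}) b F :
  F = [set x | P x /\ c x = b] -> (forall x, P x -> c x <= b) ->
  F !=set0 -> exists2 A, A \in G & F (ring_point A).
Proof.
move=> -> cb [x [Px cx]].
have cb' y : ring_points y -> c y <= b by move/sub_conv_hull/cb.
have [[y [[A GA yA] cy]]|none] := pselect ((ring_points `&` [set y | c y = b]) !=set0).
  by exists A => //; rewrite -yA; split => //; apply: sub_conv_hull; exists A.
have := conv_hull_argmax cb' Px cx.
by move/conv_aff_hull/aff_hull_nonempty.
Qed.

Lemma ring_polytope_vertices :
  finite_set (vertices P) /\ (num_vertices P <= #|G|)%N.
Proof.
have -> : #|G| = size [seq [set ring_point A] | A <- enum G].
  by rewrite size_map -cardE.
apply: card_fset_set_le => F [[c [b [cb hF]]] dF].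
have [A GA FA] := face_point hF cb (has_dim_nonempty dF).
have [x Fx] := has_dim0 dF; apply/mapP; exists A; first by rewrite mem_enum.
by move: FA; rewrite Fx /= => ->.
Qed.

Let section (l : {linear V -> R^o}) (beta : R) := [set x | P x /\ l x = beta].

Let c_point (c : {linear V -> R^o}) A :
  c (ring_point A) = c f0 + \sum_(p in A) c (g p).
Proof. by rewrite raddfD /= linear_sum. Qed.

(** If no Hasse equation held at all the members on F, the supporting functional
    would be constant on P.  Once one of them does hold, F is the whole section of
    P by that equation. *)
Lemma ring_polytope_facets :
  finite_set (facets P) /\ (num_facets P <= num_edges G)%N.
Proof.
pose mins := [seq section (phi p) 1 | p <- enum [set p | ring_min G p]%SET].
pose maxs := [seq section (phi p) 0 | p <- enum [set p | ring_max G p]%SET].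
pose covs := [seq section (phi u.1 \- phi u.2) 0
               | u <- enum [set u : 'I_d * 'I_d | ring_cover G u.1 u.2]%SET].
have -> : num_edges G = size (mins ++ maxs ++ covs).
  by rewrite !size_cat !size_map -!cardE addnA.
apply: card_fset_set_le => F [[c [b [cb hF]]] [k [dF dP]]].
rewrite !mem_cat.
have tight_ext (l : {linear V -> R^o}) beta :
    (forall A, A \in G -> c (ring_point A) = b -> l (ring_point A) = beta) ->
    forall x, F x -> l x = beta.
  move=> h x; rewrite hF => -[Px cx].
  have cb' y : ring_points y -> c y <= b by move/sub_conv_hull/cb.
  have := conv_hull_argmax cb' Px cx.
  by apply: conv_hull_affine => _ [[A GA ->] cA]; apply: h.
have facetE (l : {linear V -> R^o}) beta A0 :
    (forall A, A \in G -> c (ring_point A) = b -> l (ring_point A) = beta) ->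
    A0 \in G -> l (ring_point A0) != beta -> F = section l beta.
  move=> h GA0 lA0; rewrite hF; apply: (facet_eq_section dP).
  - by rewrite -hF.
  - by rewrite -hF; apply: tight_ext.
  - by exists (ring_point A0) => //; apply: point_P.
pose tight A := (A \in G) && (c (ring_point A) == b).
have [G0 GT _ _] := rG.
have [/existsP[p /andP[pmin /forall_inP hp]]|/existsPn nomin] :=
  boolP [exists p, ring_min G p && [forall A in [set A | tight A]%SET, p \in A]].
  apply/orP; left; apply/mapP; exists p; first by rewrite mem_enum inE.
  apply: (facetE _ _ set0) => //; last by rewrite phi_point inE eq_sym oner_eq0.
  by move=> A GA cA; rewrite phi_point hp // inE /tight GA cA eqxx.
have [/existsP[p /andP[pmax /forall_inP hp]]|/existsPn nomax] :=
  boolP [exists p, ring_max G p && [forall A in [set A | tight A]%SET, p \notin A]].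
  apply/orP; right; apply/orP; left; apply/mapP; exists p; first by rewrite mem_enum inE.
  apply: (facetE _ _ setT) => //; last by rewrite phi_point inE oner_eq0.
  by move=> A GA cA; rewrite phi_point (negbTE (hp A _)) // inE /tight GA cA eqxx.
have [/existsP[u /andP[ucov /forall_inP hu]]|/existsPn nocov] :=
  boolP [exists u : 'I_d * 'I_d, ring_cover G u.1 u.2 &&
           [forall A in [set A | tight A]%SET, (u.1 \in A) ==> (u.2 \in A)]].
  do 2![apply/orP; right]; apply/mapP; exists u; first by rewrite mem_enum inE.
  have /andP[ult _] := ucov; have [A0 [GA0 u1 u2]] := ring_lt_sep sG ult.
  apply: (facetE _ _ A0) => //=; last first.
    by rewrite !phi_point u1 (negbTE u2) subr0 oner_eq0.
  move=> A GA cA; rewrite /= !phi_point; have /andP[_ ule] := ult.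
  have /implyP tA : (u.1 \in A) ==> (u.2 \in A) by apply: hu; rewrite inE /tight GA cA eqxx.
  have -> : (u.1 \in A) = (u.2 \in A) by apply/idP/idP => // /(ring_ideal GA ule).
  exact: subrr.
exfalso; have toA A : A \in G -> \sum_(p in A) c (g p) = c (ring_point A) - c f0.
  by move=> _; rewrite c_point addrC addKr.
have c0 p : c (g p) = 0.
  apply: (weight_eq0 (w := fun p => c (g p)) (b := b - c f0) rG sG).
  - by move=> A GA; rewrite toA // lerD2r; apply/cb/point_P.
  - move=> pmin; have := nomin p; rewrite pmin => /forall_inPn[A].
    by rewrite inE => /andP[GA /eqP cA] pA; exists A; rewrite toA // cA.
  - move=> pmax; have := nomax p; rewrite pmax => /forall_inPn[A].
    by rewrite inE negbK => /andP[GA /eqP cA] pA; exists A; rewrite toA // cA.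
  - move=> r q rq; have := nocov (r, q); rewrite rq => /forall_inPn[A].
    rewrite inE negb_imply => /andP[GA /eqP cA] /andP[rA qA].
    by exists A; rewrite toA // cA.
have [A1 GA1 FA1] := face_point hF cb (has_dim_nonempty dF).
have cP x : P x -> c x = b.
  apply: conv_hull_affine => _ [A GA ->]; move: FA1; rewrite hF => -[_ <-].
  by rewrite !c_point !big1.
have FP : F = P by rewrite hF; apply/seteqP; split=> [x []|x Px] //; split=> //; apply: cP.
by have := has_dim_uniq dP; rewrite -FP => /(_ _ dF) /eqP; rewrite eqn_leq ltnn.
Qed.

End RingPolytope.

(** * The ring of all subsets and the cube *)

Section BooleanRing.
Local Open Scope classical_set_scope.
Local Open Scope ring_scope.
Variables (R : realType) (V : vectType R) (d : nat).
Variables (f0 : V) (g : 'I_d -> V) (phi : 'I_d -> {linear V -> R^o}).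
Hypothesis phi_f0 : forall p, phi p f0 = 0.
Hypothesis phi_g : forall p q, phi p (g q) = (p == q)%:R.

Lemma conv_hull_fin (A : set V) (I : finType) (p : I -> V) (a : I -> R) :
  (forall i, A (p i)) -> (forall i, 0 <= a i) -> \sum_i a i = 1 ->
  conv_hull A (\sum_i a i *: p i).
Proof.
move=> Ap a0 a1.
have sumE (T : nmodType) (F : I -> T) : \sum_(i < #|I|) F (enum_val i) = \sum_i F i.
  by rewrite [RHS](reindex (@enum_val _ I)) //; apply/onW_bij/enum_val_bij.
exists #|I|, (fun i => p (enum_val i)), (fun i => a (enum_val i)); split => //.
  by rewrite (sumE _ a).
by rewrite (sumE _ (fun i => a i *: p i)).
Qed.

Lemma ring_polytope_coord G x : ring_polytope G f0 g x ->
  x = f0 + \sum_p phi p x *: g p.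
Proof.
move=> [k [y [a [yG _ a1 ->]]]].
under [X in _ = _ + X]eq_bigr => p _ do rewrite linear_sum scaler_suml.
rewrite exchange_big -[f0 in RHS]scale1r -a1 scaler_suml -big_split /=.
apply: eq_bigr => i _; have [A GA ->] := yG i.
under [X in _ = _ + X]eq_bigr => p _ do rewrite linearZ /= (phi_point phi_f0 phi_g).
rewrite scalerDr; congr (_ + _); rewrite scaler_sumr big_mkcond; apply: eq_bigr => p _ /=.
by case: ifP => _; rewrite [_ *: _%:R]mulr_natr ?mulr1n ?mulr0n ?scale0r.
Qed.

(** A point of the unit cube is the mean of a random subset that contains each p
    independently with the p-th coordinate as probability. *)
Lemma box_in_boolean_polytope (t : 'I_d -> R) :
  (forall p, 0 <= t p <= 1) -> ring_polytope setT f0 g (f0 + \sum_p t p *: g p).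
Proof.
move=> t01; pose a (A : {set 'I_d}) := \prod_p (if p \in A then t p else 1 - t p).
have distr (F1 F2 : 'I_d -> R) : \prod_p (F1 p + F2 p) =
    \sum_(A : {set 'I_d}) \prod_p (if p \in A then F1 p else F2 p).
  by rewrite bigA_distr; apply: eq_bigl => A; rewrite inE.
have a1 : \sum_A a A = 1.
  by rewrite -(distr t (fun p => 1 - t p)) big1 // => p _; rewrite subrKC.
have ap p : \sum_A a A * (p \in A)%:R = t p.
  (* the expected weight of p: expand the product with the factors 1 - t p removed *)
  have -> : t p = \prod_q (t q + (if q == p then 0 else 1 - t q)).
    rewrite (bigD1 p) //= eqxx addr0 big1 ?mulr1 // => q /negbTE->.
    by rewrite subrKC.
  rewrite distr; apply: eq_bigr => A _; have [pA|pA] := boolP (p \in A).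
    rewrite mulr1; apply: eq_bigr => q _; case: ifPn => // qA; case: eqP => // qp.
    by rewrite qp pA in qA.
  by rewrite mulr0 (bigD1 p) //= (negbTE pA) eqxx mul0r.
have -> : f0 + \sum_p t p *: g p = \sum_A a A *: ring_point f0 g A.
  under [RHS]eq_bigr => A _ do rewrite /ring_point scalerDr.
  rewrite big_split /= -scaler_suml a1 scale1r; congr (_ + _).
  under [LHS]eq_bigr => p _ do rewrite -ap scaler_suml.
  rewrite exchange_big; apply: eq_bigr => A _ /=.
  rewrite scaler_sumr [RHS]big_mkcond; apply: eq_bigr => p _.
  by case: ifP => _; rewrite ?mulr1 ?mulr0 ?scale0r.
apply: conv_hull_fin => // [A|A]; first by exists A; rewrite ?inE.
by apply: prodr_ge0 => p _; case: ifP => _; have := t01 p; lra.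
Qed.

Let coords (x : V) : 'rV[R]_d := \row_p (phi p x *+ 2).

Fact coords_linear : linear coords.
Proof.
move=> k x y; apply/rowP => p; rewrite !mxE linearP /= mulrnDl; congr (_ + _).
by rewrite -mulrnAr.
Qed.
HB.instance Definition _ := GRing.isLinear.Build R V 'rV[R]_d *:%R coords coords_linear.

Lemma boolean_polytope_cube :
  affinely_isomorphic (ring_polytope setT f0 g) (cube R d).
Proof.
exists (coords : {linear V -> 'rV[R]_d}), (const_mx (-1)).
have coordE x p : (coords x + const_mx (-1)) 0 p = phi p x *+ 2 - 1 by rewrite !mxE.
split.
- move=> x Px p; rewrite coordE.
  have ge0 : phi p x <= 1.
    apply: conv_hull_le Px => _ [A _ ->]; rewrite (phi_point phi_f0 phi_g).
    by case: (p \in A) => /=; lra.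
  have le1 : (\- phi p) x <= 0.
    apply: conv_hull_le Px => _ [A _ ->]; rewrite /= (phi_point phi_f0 phi_g).
    by rewrite oppr_le0 ler0n.
  by move: ge0 le1; rewrite /= oppr_le0 => h1 h2; apply/andP; split; lra.
- move=> x y /set_mem Px /set_mem Py /rowP xy.
  rewrite (ring_polytope_coord Px) (ring_polytope_coord Py); congr (_ + _).
  apply: eq_bigr => p _; congr (_ *: _); have := xy p; rewrite !coordE; lra.
move=> y cy; pose t p := (y 0 p + 1) / 2.
exists (f0 + \sum_p t p *: g p).
  by apply: box_in_boolean_polytope => p; have := cy p; rewrite /t; lra.
apply/rowP => p; rewrite coordE raddfD /= phi_f0 add0r linear_sum (bigD1 p) //=.
rewrite big1 => [|q /negbTE nq]; rewrite linearZ /= phi_g.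
  by rewrite eqxx addr0 [_ *: _]mulr1 /t; lra.
by rewrite eq_sym nq [_ *: _]mulr0.
Qed.

End BooleanRing.

(** * Faces of an affinely isomorphic polytope *)

Section PulledBackFaces.
Local Open Scope classical_set_scope.
Local Open Scope ring_scope.
Variables (R : realType) (V V' : vectType R) (P : set V) (Q : set V').
Variables (f : {linear V -> V'}) (t : V').
Hypothesis bij : set_bij P Q (fun x => f x + t).
Implicit Types b : R.

Definition pullback (F : set V') : set V := [set x | P x /\ F (f x + t)].

Lemma iso_preimage y : Q y -> exists2 x, P x & f x + t = y.
Proof. by case: bij => _ _ /(_ y) h /h[x Px <-]; exists x. Qed.

Lemma iso_image x : P x -> Q (f x + t).
Proof. by case: bij => h _ _ Px; exact: h. Qed.

Lemma pullback_neq F F' y : Q y -> F y -> ~ F' y -> pullback F <> pullback F'.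
Proof.
move=> /iso_preimage[x Px <-] Fy F'y /seteqP[h _].
by have [|_ /F'y] := h x; first split.
Qed.

Lemma pullback_face (c : {linear V' -> R^o}) b :
  (forall y, Q y -> c y <= b) -> face P (pullback [set y | c y = b]).
Proof.
move=> cb; exists (c \o f : {linear _ -> _}), (b - c t); split=> [x /iso_image/cb|].
  by rewrite raddfD /= lerBrDr.
apply/seteqP; split=> x /= [Px] h; split=> //.
  by rewrite -h /= raddfD /= addrK.
by rewrite /= raddfD /= h subrK.
Qed.

Lemma pullback_vertex (c : {linear V' -> R^o}) b y0 :
  Q y0 -> (forall y, Q y -> c y <= b) -> (forall y, Q y -> c y = b <-> y = y0) ->
  vertices P (pullback [set y0]).
Proof.
move=> Qy0 cb cy0; split.
  suff -> : pullback [set y0] = pullback [set y | c y = b] by apply: pullback_face.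
  by apply/seteqP; split=> x [Px /= h]; split=> //=; apply/(cy0 _ (iso_image Px)).
have [x Px xy] := iso_preimage Qy0; have [_ inj _] := bij.
suff -> : pullback [set y0] = [set x] by apply: has_dim_set1.
apply/seteqP; split=> z /= => [[Pz]|->]; last by split.
by rewrite -xy => h; apply: inj => //; apply/mem_set.
Qed.

Lemma pullback_facet (c : {linear V' -> R^o}) b k (q : 'I_k -> V') q0 z :
  has_dim P k.+1 -> (forall y, Q y -> c y <= b) ->
  Q q0 -> c q0 = b -> (forall i, Q (q i)) -> (forall i, c (q i) = b) ->
  Q z -> c z != b ->
  (forall a : 'I_k -> R, \sum_i a i *: (q i - q0) = 0 -> forall i, a i = 0) ->
  facets P (pullback [set y | c y = b]).
Proof.
move=> dP cb Qq0 cq0 Qq cq Qz cz free_q; split; first exact: pullback_face.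
exists k; split=> //; have [x0 Px0 x0E] := iso_preimage Qq0.
have [w Pw wE] := iso_preimage Qz.
have /choice[x xE] i : exists x, P x /\ f x + t = q i.
  by have [x Px xE] := iso_preimage (Qq i); exists x.
pose c' : {linear V -> R^o} := c \o f; pose b' := b - c t.
have c'E x' y : f x' + t = y -> (c' x' = b') <-> (c y = b).
  by move=> <-; rewrite /b' /= raddfD /=; split=> [->|<-]; rewrite ?subrK ?addrK.
have -> : pullback [set y | c y = b] = [set x | P x /\ c' x = b'].
  by apply/seteqP; split=> y [Py /=] h; split=> //; apply/(c'E _ _ erefl).
apply: (has_dim_facet (q := x) (q0 := x0) (y := w)) => //.
- by split=> //; apply/(c'E _ _ x0E).
- by move=> i; have [Px xi] := xE i; split=> //; apply/(c'E _ _ xi).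
- by apply: contra cz => /eqP h; apply/eqP/(c'E _ _ wE).
move=> a ha; apply: free_q; rewrite -[RHS](linear0 f) -ha linear_sum.
apply: eq_bigr => i _; rewrite -(proj2 (xE i)) -x0E linearZ /= (linearB f).
by rewrite opprD addrACA subrr addr0.
Qed.

End PulledBackFaces.

(** * Vertices and facets of cubes and cross-polytopes *)

Section CubesAndCrossPolytopes.
Local Open Scope classical_set_scope.
Local Open Scope ring_scope.
Variable R : realType.

Definition dot d (a y : 'rV[R]_d) : R^o := \sum_i a 0 i * y 0 i.

Fact dot_linear d (a : 'rV[R]_d) : linear (dot a).
Proof.
move=> k x y; rewrite /dot scaler_sumr -big_split; apply: eq_bigr => i _ /=.
by rewrite !mxE mulrDr mulrCA.
Qed.
HB.instance Definition _ d (a : 'rV[R]_d) :=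
  GRing.isLinear.Build R 'rV[R]_d R^o *:%R (dot a) (dot_linear a).

Definition sign_vec d (s : {set 'I_d}) : 'rV[R]_d := \row_i (-1) ^+ (i \in s).

Definition signed_unit d (u : 'I_d * bool) : 'rV[R]_d :=
  (-1) ^+ u.2 *: delta_mx 0 u.1.

Lemma dotC d (x y : 'rV[R]_d) : dot x y = dot y x.
Proof. by apply: eq_bigr => i _; rewrite mulrC. Qed.

Lemma dot_unit d u (y : 'rV[R]_d) : dot (signed_unit u) y = (-1) ^+ u.2 * y 0 u.1.
Proof.
rewrite /dot (bigD1 u.1) //= big1 ?addr0 => [|j nj]; rewrite !mxE eqxx /=.
  by rewrite eqxx mulr1.
by rewrite (negbTE nj) mulr0 mul0r.
Qed.

Lemma signed_unitE d (u : 'I_d * bool) i :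
  signed_unit u 0 i = (-1) ^+ u.2 * (i == u.1)%:R.
Proof. by rewrite !mxE eqxx. Qed.

Lemma sign_cube d (s : {set 'I_d}) : cube R d (sign_vec s).
Proof. by move=> i; rewrite mxE; case: (i \in s); rewrite ?expr0 ?expr1; lra. Qed.

Lemma unit_cube d (u : 'I_d * bool) : cube R d (signed_unit u).
Proof.
by move=> i; rewrite signed_unitE; case: (i == u.1); case: u.2; rewrite /= ?expr0 ?expr1; lra.
Qed.

Lemma cube_sign_le d (y : 'rV[R]_d) (b : bool) i : cube R d y -> (-1) ^+ b * y 0 i <= 1.
Proof. by move=> /(_ i); case: b; rewrite /= ?expr0 ?expr1; lra. Qed.

Lemma unit_cross d (u : 'I_d * bool) : cross_polytope R d (signed_unit u).
Proof.
by move=> x cx; rewrite -/(dot x _) dotC dot_unit cube_sign_le.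
Qed.

Lemma sign_cross_le d (s : {set 'I_d}) y : cross_polytope R d y -> dot (sign_vec s) y <= 1.
Proof. by apply; apply: sign_cube. Qed.

Section Counting.
Variables (V : vectType R) (P : set V) (d : nat).
Hypotheses (dP : has_dim P d) (fv : finite_set (vertices P)) (ff : finite_set (facets P)).

Let card_signs : #|{set 'I_d}| = (2 ^ d)%N.
Proof. by rewrite -cardsT -powersetT card_powerset cardsT card_ord. Qed.

Let card_units : #|{: 'I_d * bool}| = (d * 2)%N.
Proof. by rewrite card_prod card_ord card_bool. Qed.

(** The functional of a sign vector attains its maximum d over the cube only there. *)
Lemma cube_vertices_ge f t :
    set_bij P (cube R d) (fun x => (f : {linear V -> 'rV[R]_d}) x + t) ->
  (2 ^ d <= num_vertices P)%N.
Proof.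
move=> bij; rewrite -card_signs.
apply: (card_fset_set_ge (h := fun s => pullback P f t [set sign_vec s])) => //.
  move=> s s' h; apply/setP => i; apply/eqP; apply: contraT => ni; exfalso.
  move: h; apply: (pullback_neq bij (sign_cube s)) => //= /rowP/(_ i).
  by move: ni; rewrite !mxE; case: (i \in s); case: (i \in s') => //= _; rewrite ?expr0 ?expr1; lra.
move=> s; apply: (pullback_vertex bij (c := dot (sign_vec s)) (b := \sum_(i < d) 1)).
- exact: sign_cube.
- by move=> y cy; apply: ler_sum => i _; rewrite mxE cube_sign_le.
move=> y cy; split=> [h|->]; last first.
  by apply: eq_bigr => i _; rewrite mxE -expr2 sqrr_sign.
apply/rowP => i; rewrite mxE.
have : \sum_i (1 - sign_vec s 0 i * y 0 i) = 0.
  by rewrite sumrB; apply/eqP; rewrite subr_eq0; apply/eqP/esym/h.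
move/eqP; rewrite psumr_eq0 => [/allP/(_ i)|j _]; last by rewrite mxE subr_ge0 cube_sign_le.
rewrite mem_index_enum mxE => /(_ isT); rewrite subr_eq0 => /eqP.
by case: (i \in s); rewrite ?expr0 ?expr1; lra.
Qed.

(** A facet of the cube contains one sign vector and its flips at the k free
    coordinates, where d = k + 1. *)
Lemma cube_facets_ge f t :
    set_bij P (cube R d) (fun x => (f : {linear V -> 'rV[R]_d}) x + t) ->
  (d * 2 <= num_facets P)%N.
Proof.
move=> bij; rewrite -card_units.
apply: (card_fset_set_ge
         (h := fun u => pullback P f t [set y | dot (signed_unit u) y = 1])) => //.
  move=> u u' h; apply/eqP; apply: contraT => nu; exfalso.
  (* y is on the facet of u but not on that of u' *)
  pose y : 'rV[R]_d := \row_i (-1) ^+ (if i == u.1 then u.2 else ~~ u'.2).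
  have cy : cube R d y.
    by move=> i; rewrite mxE; case: (if _ then _ else _); rewrite ?expr0 ?expr1; lra.
  move: h; apply: (pullback_neq bij cy) => /=; rewrite dot_unit mxE.
    by rewrite eqxx -expr2 sqrr_sign.
  case: eqP => [e|_]; last by case: u'.2; rewrite /= ?expr0 ?expr1; lra.
  case: u u' nu e {y cy} => i b [i' b'] /= nu e; move: nu; rewrite e xpair_eqE eqxx /=.
  by case: b; case: b' => //=; rewrite ?expr0 ?expr1; lra.
move=> [i b]; move: f t bij dP i; case: (d) => [|k] f' t' bij' dP' i; first by case: i.
pose s0 : {set 'I_k.+1} := if b then setT else set0.
have s0E j : sign_vec s0 0 j = (-1) ^+ b by rewrite mxE /s0; case: (b); rewrite inE.
pose s j := if b then setC (set1 (lift i j)) else set1 (lift i j).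
have sE j j' : sign_vec (s j) 0 j' = (-1) ^+ (b (+) (j' == lift i j)).
  by rewrite mxE /s; case: (b); rewrite !inE.
apply: (pullback_facet bij' (c := dot (signed_unit (i, b))) (b := 1)
          (q := fun j => sign_vec (s j)) (q0 := sign_vec s0)
          (z := - sign_vec s0)) => //.
- by move=> y cy; rewrite /= dot_unit cube_sign_le.
- exact: sign_cube.
- by rewrite /= dot_unit s0E -expr2 sqrr_sign.
- by move=> j; apply: sign_cube.
- by move=> j; rewrite /= dot_unit sE /= (negbTE (neq_lift _ _)) addbF -expr2 sqrr_sign.
- by move=> j; rewrite mxE s0E; case: (b); rewrite ?expr0 ?expr1; lra.
- rewrite raddfN /= dot_unit s0E -expr2 sqrr_sign; apply/negP => /eqP; lra.
move=> a ha j; have /rowP/(_ (lift i j)) := ha.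
rewrite summxE (bigD1 j) //= big1 => [|j' nj]; last first.
  by rewrite mxE [X in _ * X]mxE sE mxE s0E (inj_eq lift_inj) eq_sym (negbTE nj) addbF subrr mulr0.
rewrite addr0 mxE [X in _ * X]mxE sE mxE s0E eqxx mxE.
by case: (b); rewrite /= ?expr0 ?expr1; lra.
Qed.

(** If one coordinate is 1 or -1, pairing with points of the cube forces all the
    others to vanish. *)
Lemma cross_vertices_ge f t :
    set_bij P (cross_polytope R d) (fun x => (f : {linear V -> 'rV[R]_d}) x + t) ->
  (d * 2 <= num_vertices P)%N.
Proof.
move=> bij; rewrite -card_units.
apply: (card_fset_set_ge (h := fun u => pullback P f t [set signed_unit u])) => //.
  move=> u u' h; apply/eqP; apply: contraT => nu; exfalso.
  move: h; apply: (pullback_neq bij (unit_cross u)) => //= /rowP/(_ u.1).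
  rewrite !signed_unitE eqxx mulr1; case: eqP => [e|_]; last first.
    by rewrite mulr0 => /eqP; rewrite signr_eq0.
  case: u u' nu e => i b [i' b'] /= nu e; move: nu; rewrite e xpair_eqE eqxx /=.
  by case: b; case: b' => //=; rewrite ?expr0 ?expr1; lra.
move=> u; apply: (pullback_vertex bij (c := dot (signed_unit u)) (b := 1)).
- exact: unit_cross.
- by move=> y; apply; apply: unit_cube.
move=> y cy; split=> [|->] /=; last first.
  by rewrite dot_unit signed_unitE eqxx mulr1 -expr2 sqrr_sign.
rewrite dot_unit => yu; apply/rowP => j; rewrite signed_unitE.
have [->|nj] := eqVneq j u.1; first by rewrite -[LHS](signrMK u.2) yu.
(* the sum of two signed units on different axes is a point of the cube *)
have two (b : bool) : (-1) ^+ b * y 0 j <= 0.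
  have cx : cube R d (signed_unit u + signed_unit (j, b)).
    move=> i; rewrite mxE !signed_unitE /=; have [->|ni] := eqVneq i u.1.
      by rewrite eq_sym (negbTE nj); case: u.2; rewrite /= ?expr0 ?expr1; lra.
    by case: (i == j); case: b; rewrite /= ?expr0 ?expr1; lra.
  by have := cy _ cx; rewrite -/(dot _ y) dotC raddfD /= ![dot y _]dotC !dot_unit yu gerDl.
by have := two false; have := two true; rewrite /= expr0 expr1 mulr0; lra.
Qed.

(** A facet of the cross-polytope contains one signed unit vector on each axis.
    For d = 0 there is one sign vector but no facet. *)
Lemma cross_facets_ge f t : (0 < d)%N ->
    set_bij P (cross_polytope R d) (fun x => (f : {linear V -> 'rV[R]_d}) x + t) ->
  (2 ^ d <= num_facets P)%N.
Proof.
move=> d0 bij; rewrite -card_signs.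
apply: (card_fset_set_ge
         (h := fun s => pullback P f t [set y | dot (sign_vec s) y = 1])) => //.
  move=> s s' h; apply/setP => i; apply/eqP; apply: contraT => ni; exfalso.
  move: h; apply: (pullback_neq bij (unit_cross (i, i \in s))) => /=.
    by rewrite dotC dot_unit mxE -expr2 sqrr_sign.
  rewrite dotC dot_unit mxE /=; move: ni.
  by case: (i \in s); case: (i \in s') => //= _; rewrite ?expr0 ?expr1; lra.
move=> s; move: d0 f t bij dP s; case: (d) => [//|k] _ f' t' bij' dP' s.
pose q j := signed_unit (j, j \in s).
have dq j : dot (sign_vec s) (q j) = 1 by rewrite dotC dot_unit mxE -expr2 sqrr_sign.
apply: (pullback_facet bij' (c := dot (sign_vec s)) (b := 1)
          (q := fun j => q (lift ord0 j)) (q0 := q ord0) (z := 0)) => //.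
- by move=> y cy; apply: sign_cross_le.
- exact: unit_cross.
- exact: dq.
- by move=> j; apply: unit_cross.
- by move=> j; apply: dq.
- by move=> x _; rewrite big1 // => j _; rewrite mxE mulr0.
- by rewrite linear0 eq_sym oner_eq0.
move=> a ha j; have qE j' : (q (lift ord0 j') - q ord0) 0 (lift ord0 j)
    = (-1) ^+ (lift ord0 j' \in s) * (j == j')%:R.
  rewrite mxE [X in _ + X]mxE !signed_unitE /= (inj_eq lift_inj).
  by rewrite mulr0 subr0.
have /rowP/(_ (lift ord0 j)) := ha.
rewrite summxE (bigD1 j) //= big1 => [|j' nj]; last first.
  by rewrite mxE qE eq_sym (negbTE nj) !mulr0.
rewrite addr0 mxE qE eqxx mulr1 mxE.
by move/eqP; rewrite mulf_eq0 signr_eq0 orbF => /eqP.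
Qed.

End Counting.
End CubesAndCrossPolytopes.

(** * The stable matching polytope *)

Section StableMatchingPolytope.
Local Open Scope classical_set_scope.
Local Open Scope ring_scope.
Variables (R : realType) (M W : finType) (I : marriage_instance M W).
Hypothesis cardMW : #|M| = #|W|.

Let V := {ffun M * W -> R^o}.

Definition tail_sum (e : M * W) (x : V) : R^o :=
  \sum_(w | leM I e.1 e.2 w) x (e.1, w).

Fact tail_sum_linear e : linear (tail_sum e).
Proof.
move=> k x y; rewrite /tail_sum scaler_sumr -big_split; apply: eq_bigr => w _ /=.
by rewrite !ffunE.
Qed.
HB.instance Definition _ e :=
  GRing.isLinear.Build R V R^o *:%R (tail_sum e) (tail_sum_linear e).

Definition tail_sums (x : V) : V := [ffun e => tail_sum e x].

Fact tail_sums_linear : linear tail_sums.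
Proof. by move=> k x y; apply/ffunP => e; rewrite !ffunE linearP. Qed.
HB.instance Definition _ :=
  GRing.isLinear.Build R V V *:%R tail_sums tail_sums_linear.

(** The most preferred entry in the support of x would be the value of the tail
    sum that starts there. *)
Lemma tail_sums_inj x : tail_sums x = 0 -> x = 0.
Proof.
move=> x0; apply/ffunP => -[m w0]; rewrite ffunE; apply/eqP; apply: contraT => xw0.
have [irr tr _] := ltM_order I m.
pose below w := #|[set w' | ltM I m w' w]%SET|.
case: (@arg_maxnP _ w0 (fun w => x (m, w) != 0) below xw0) => w xw wmax.
have /ffunP/(_ (m, w)) := x0; rewrite !ffunE /tail_sum /= (bigD1 w) /=; last first.
  by rewrite /leM eqxx.
rewrite big1 ?addr0 => [h|w' /andP[/orP[/eqP->|lt] nw]].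
- by rewrite h eqxx in xw.
- by rewrite eqxx in nw.
apply/eqP; apply: contraT => xw'; have := wmax w' xw'; rewrite /= leqNgt => /negP; case.
apply: proper_card; apply/properP; split.
  by apply/subsetP => u; rewrite !inE => ut; apply: tr ut lt.
by exists w; rewrite !inE ?irr.
Qed.

Lemma tail_sums_profile mu e : stable_matching I mu ->
  tail_sum e (char_vec R mu) = (e \in profile I mu)%:R.
Proof.
move=> /stable_matching_pair[f [h [_ ->]]]; rewrite profile_matching_of /tail_sum.
have xE w : char_vec R (matching_of f) (e.1, w) = (f e.1 == w)%:R by rewrite ffunE inE.
under eq_bigr => w _ do rewrite xE.
rewrite big_mkcond (bigD1 (f e.1)) //= eqxx big1 ?addr0; first by case: ifP.
by move=> w nw; rewrite eq_sym (negbTE nw) if_same.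
Qed.

(** With T the inverse of the tail sums, the characteristic vector of a matching
    is T of the indicator of its profile, which is the sum of the indicators of
    the blocks it contains. *)
Lemma stable_polytope_ring mu0 : stable_matching I mu0 ->
  exists d (G : {set {set 'I_d}}) (f0 : V) (g : 'I_d -> V) (phi : 'I_d -> {linear V -> R^o}),
    [/\ set_ring G, separating G, forall p, phi p f0 = 0,
        forall p q, phi p (g q) = (p == q)%:R
      & stable_matching_polytope R I = ring_polytope G f0 g].
Proof.
move=> st0; pose U := linfun (tail_sums : {linear V -> V}).
have kerU : lker U == 0%VS.
  apply/lker0P => x y; rewrite !lfunE /= => xy; apply/eqP; rewrite -subr_eq0; apply/eqP.
  by apply: tail_sums_inj; rewrite raddfB /= xy subrr.
pose T y := (U^-1)%VF y.
have UT y : tail_sums (T y) = y.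
  by have := lker0_lfunVK kerU y; rewrite lfunE.
have TU x : T (tail_sums x) = x by rewrite /T -(lfunE tail_sums) lker0_lfunK.
pose ind (S : {set M * W}) : V := [ffun e => (e \in S)%:R].
have D0 : profiles I != set0.
  by apply/set0Pn; exists (profile I mu0); apply: imset_f.
have [d [G [a [B0 [B [[rG sG] a0 aB dec dec']]]]]] :=
  ring_quotient D0 (profilesI cardMW) (profilesU cardMW).
have pointE S A : decomposes B0 B S A ->
    ring_point (T (ind B0)) (fun i => T (ind (B i))) A = T (ind S).
  move=> SA; rewrite /ring_point /T -raddf_sum -raddfD; congr (_ _).
  apply/ffunP => e; rewrite !ffunE sum_ffunE SA natrD natr_sum; congr (_ + _).
  by apply: eq_bigr => i _; rewrite ffunE.
have charE mu : stable_matching I mu -> char_vec R mu = T (ind (profile I mu)).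
  move=> st; rewrite -[LHS]TU; congr (T _); apply/ffunP => e.
  by rewrite !ffunE tail_sums_profile.
exists d, G, (T (ind B0)), (fun i => T (ind (B i))), (fun i => tail_sum (a i)); split=> //.
- move=> p; have /ffunP/(_ (a p)) := UT (ind B0); rewrite !ffunE /= => ->.
  by rewrite (negbTE (a0 p)).
- move=> p q; have /ffunP/(_ (a p)) := UT (ind (B q)); rewrite !ffunE /= => ->.
  by rewrite aB.
congr (conv_hull _); apply/seteqP; split=> [_ [mu st ->]|_ [A GA ->]].
  have [A GA SA] := dec _ (imset_f (profile I) st).
  by exists A => //; rewrite (pointE _ _ SA) charE.
have [_ /imsetP[mu st ->] SA] := dec' A GA.
by exists mu => //; rewrite (pointE _ _ SA) charE.
Qed.

End StableMatchingPolytope.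

Theorem corollary19 (R : realType) (M W : finType) (n : nat)
    (hM : #|M| = n) (hW : #|W| = n) (I : marriage_instance M W) (d : nat)
    (hd : has_dim (stable_matching_polytope R I) d) :
  let P := stable_matching_polytope R I in
  (num_vertices P * num_facets P <= d * 2 ^ d.+1)%N /\
  ((num_vertices P * num_facets P = d * 2 ^ d.+1)%N <->
   affinely_isomorphic P (cube R d) \/
   affinely_isomorphic P (cross_polytope R d)).
Proof.
move=> P.
have [mu st] : exists mu, stable_matching I mu.
  have [x Px] := has_dim_nonempty hd.
  by have [_ [mu st _]] := aff_hull_nonempty (conv_aff_hull Px); exists mu.
have [k [G [f0 [g [phi [rG sG phi0 phig PE]]]]]] :=
  stable_polytope_ring R (etrans hM (esym hW)) st.
have dk : d = k by apply: (ring_polytope_dim rG sG phig (f0 := f0)); rewrite -PE.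
case: k / dk G f0 g phi rG sG phi0 phig PE => G f0 g phi rG sG phi0 phig PE.
have [finV leV] := ring_polytope_vertices G f0 g.
have [finF leF] := ring_polytope_facets rG sG phi0 phig.
have leE := ring_edges_le sG; have eqE := ring_edges_eq rG sG.
rewrite -/P in PE hd; rewrite -PE card_ord in finV leV finF leF leE eqE.
have le : (num_vertices P * num_facets P <= d * 2 ^ d.+1)%N.
  exact: leq_trans (leq_mul leV leF) leE.
split=> //; split=> [eqVF|iso].
  left; rewrite PE eqE; first exact: boolean_polytope_cube phi0 phig.
  by apply/eqP; rewrite eqn_leq leE -eqVF leq_mul.
apply/eqP; rewrite eqn_leq le /=.
have -> : (d * 2 ^ d.+1 = 2 ^ d * (d * 2))%N by rewrite expnS; lia.
case: iso => -[f [b bij]].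
  exact: leq_mul (cube_vertices_ge finV bij) (cube_facets_ge hd finF bij).
have [->//|d0] := posnP d.
rewrite mulnC; apply: leq_mul; first exact: cross_vertices_ge bij.
exact: cross_facets_ge bij.
Qed.
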